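(* There exists a finite group $G$ of order $3^{84}$ and nilpotency class exactly three which is an E-group, i.e. such that $[a,\varphi(a)]=1$ for every $a\in G$ and every group endomorphism $\varphi$ of $G$.
   Context: The commutator is $[x,y]=x^{-1}y^{-1}xy$. A group $G$ is an E-group if every element $a\in G$ commutes with $\varphi(a)$ for every endomorphism $\varphi\in\operatorname{End}(G)$. *)

(* Defs.v *)
From HB Require Import structures.
From mathcomp Require Import all_boot all_fingroup all_solvable.

Set Implicit Arguments.
Unset Strict Implicit.
Unset Printing Implicit Defensive.

Local Open Scope group_scope.

(* An endomorphism of G is a morphism with domain G whose image lies in G;   *)
(* [~ x, y] is x^-1 * y^-1 * x * y.                                          *)
Definition E_group (gT : finGroupType) (G : {group gT}) : Prop :=
  forall phi : {morphism G >-> gT}, phi @* G \subset G ->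
  forall a : gT, a \in G -> [~ a, phi a] = 1.

(* Main.v *)
Require Import Defs.
From HB Require Import structures.
From mathcomp Require Import all_boot all_fingroup all_solvable.
From mathcomp Require Import all_algebra ring zify.

Set Implicit Arguments.
Unset Strict Implicit.
Unset Printing Implicit Defensive.

(** The group comes from a linear map P : V -> Lambda^2 V, where V = F_3^9 has
    the basis e_0, ..., e_8. Let M be the quotient of Lambda^3 V by the elements
    P(x) /\ x. There is an additive group E with layers V, Lambda^2 V and M in
    which 3 x = P(x) for x in V and 3 (x /\ y) = P(x) /\ y, and it carries the
    alternating bracket [x, y] = x /\ y, [x /\ y, z] = x /\ y /\ z. This bracket
    is well defined because P(x) /\ y is antisymmetric in x and y modulo the
    relations. For the map P used here the 45 relations are independent, so E has
    order 3^(9 + 36 + 39) = 3^84.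

    Double brackets are alternating, and in characteristic 3 an alternating
    trilinear map is the coboundary of an explicit cochain. Hence E is a group
    under x + y + [x, y] + (a correction in M), see [twist_mulA]; its commutators
    are the elements 2 [x, y], and its powers are the multiples k x. So it has
    class three, and x and y commute when [x, y] = 0.

    Let phi be an endomorphism of this group. It preserves brackets and multiples.
    On V it induces a matrix R compatible with P ([endo_mx]), and P is chosen so
    that R = 0 or R = 1 ([rigidity]): P is dual to an anticommutative product on
    V^*, on which R acts as an endomorphism. A nonzero one turns out to be
    invertible; it then preserves the traces of left multiplications, hence a
    vector defined by these traces, hence the left multiplication N by this
    vector and all the linear forms (trace).N^k, which span the dual space.

    If R = 0, then the values of phi on the e_i have order dividing 3, and such
    elements lie in M, which is central. If R = 1, then phi(x) = x + c(x) modulo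
    M, where c : V -> Lambda^2 V is linear. Applying phi to the relations
    3 e_i = P(e_i) gives a linear system for c. By Gaussian elimination its only
    solutions are c(x) = x /\ u ([inner_solution]), and [x, x /\ u] = 0. In both
    cases [x, phi(x)] = 0 ([bracket_endo]). *)

Import GRing.Theory.
Local Open Scope ring_scope.

(** * Extensions with prescribed cubes *)

(** The cocycle that defines Z/9 as an extension of Z/3. *)
Definition carry (a b : 'F_3) : nat := (a + b)%N %/ 3.

Lemma F3_add_carry (a b : 'F_3) : (a + b = (a + b)%R + 3 * carry a b)%N.
Proof. by rewrite [LHS](divn_eq _ 3) addnC mulnC. Qed.

Lemma carryC a b : carry a b = carry b a. Proof. by rewrite /carry addnC. Qed.

Lemma carry0 a : carry a 0 = 0%N.
Proof. by rewrite /carry addn0 divn_small ?ltn_ord. Qed.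

Lemma carry_assoc a b c :
  (carry a b + carry (a + b)%R c = carry b c + carry a (b + c)%R)%N.
Proof.
have := F3_add_carry (a + b) c; have := F3_add_carry a (b + c).
rewrite addrA; have := F3_add_carry a b; have := F3_add_carry b c.
move: (carry a b) (carry b c) (carry (a + b) c) (carry a (b + c)) => p q s t.
move: (nat_of_ord (a + b + c)) (nat_of_ord (a + b)) (nat_of_ord (b + c)) => u v w.
by move: (a : nat) (b : nat) (c : nat) => i j k; lia.
Qed.

Fact ext_lock : unit. Proof. exact: tt. Qed.

Section CarryExtension.
Variables (I : finType) (W : finZmodType).

(** Strings of ternary digits indexed by I, with carries in W: the extension of
    F_3^I by W in which three times the i-th unit string is r i. *)
Definition carry_ext (r : I -> W) : Type := ({ffun I -> 'F_3} * W)%type.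

Variable r : I -> W.
Local Notation E := (carry_ext r).
HB.instance Definition _ := Finite.on E.

(** The operations are locked: deciding by unfolding that two sums differ would
    expand the tables that define r in the case of interest. *)
Definition ext_add := locked_with ext_lock (fun x y : E =>
  (x.1 + y.1, x.2 + y.2 + \sum_i r i *+ carry (x.1 i) (y.1 i)) : E).
Definition ext_opp := locked_with ext_lock (fun x : E =>
  (- x.1, - x.2 - \sum_i r i *+ carry (x.1 i) (- x.1 i)) : E).

Lemma ext_add_unlock x y : ext_add x y =
  (x.1 + y.1, x.2 + y.2 + \sum_i r i *+ carry (x.1 i) (y.1 i)).
Proof. by rewrite /ext_add locked_withE. Qed.

Lemma ext_opp_unlock x : ext_opp x =
  (- x.1, - x.2 - \sum_i r i *+ carry (x.1 i) (- x.1 i)).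
Proof. by rewrite /ext_opp locked_withE. Qed.

Fact ext_addA : associative ext_add.
Proof.
move=> x y z; rewrite !ext_add_unlock; congr pair; rewrite /= ?addrA // -!addrA.
do 2![congr (_ + _)]; rewrite [RHS]addrCA; congr (_ + _).
rewrite -!big_split; apply: eq_bigr => i _ /=.
by rewrite !ffunE -!mulrnDr carry_assoc.
Qed.

Fact ext_addC : commutative ext_add.
Proof.
move=> x y; rewrite !ext_add_unlock; congr pair; first exact: addrC.
by congr (_ + _); [exact: addrC | apply: eq_bigr => i _; rewrite carryC].
Qed.

Fact ext_add0 : left_id (0, 0) ext_add.
Proof.
case=> v w; rewrite ext_add_unlock; congr pair; rewrite /= add0r // big1 ?addr0 // => i _.
by rewrite ffunE carryC carry0.
Qed.

Fact ext_addN : left_inverse (0, 0) ext_opp ext_add.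
Proof.
case=> v w; rewrite ext_add_unlock ext_opp_unlock; congr pair; rewrite /= ?addNr // addrAC.
rewrite [X in _ + X + _](eq_bigr (fun i => r i *+ carry (v i) (- v i))) ?subrK ?addNr //.
by move=> i _; rewrite ffunE carryC.
Qed.

HB.instance Definition _ :=
  GRing.isZmodule.Build E ext_addA ext_addC ext_add0 ext_addN.

Lemma card_carry_ext : #|{: E}| = (3 ^ #|I| * #|W|)%N.
Proof. by rewrite card_prod card_ffun card_ord. Qed.

Definition inner (w : W) : E := (0, w).
Definition lifted (i : I) : E := ([ffun j => (j == i)%:R], 0).

Lemma ext_addE (x y : E) :
  x + y = (x.1 + y.1, x.2 + y.2 + \sum_i r i *+ carry (x.1 i) (y.1 i)).
Proof. exact: ext_add_unlock. Qed.

Definition digits (x : E) : {ffun I -> 'F_3} := x.1.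

Fact digits_is_nmod_morphism : nmod_morphism digits.
Proof. by split=> // x y; rewrite ext_addE. Qed.

HB.instance Definition _ :=
  GRing.isNmodMorphism.Build E _ digits digits_is_nmod_morphism.

Lemma digitsD : {morph digits : x y / x + y}. Proof. exact: raddfD. Qed.

Lemma digitsN x : digits (- x) = - digits x. Proof. exact: raddfN. Qed.

Lemma digitsMn x k : digits (x *+ k) = digits x *+ k. Proof. exact: raddfMn. Qed.

Lemma digits_sum J (s : seq J) F :
  digits (\sum_(j <- s) F j) = \sum_(j <- s) digits (F j).
Proof. exact: raddf_sum. Qed.

Lemma digits0 : digits 0 = 0. Proof. exact: raddf0. Qed.

Fact inner_is_nmod_morphism : nmod_morphism inner.
Proof.
split=> // w w'; rewrite ext_addE /inner /= addr0 big1 ?addr0 // => i _.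
by rewrite ffunE carry0.
Qed.

HB.instance Definition _ :=
  GRing.isNmodMorphism.Build W E inner inner_is_nmod_morphism.

Lemma innerD : {morph inner : w w' / w + w'}. Proof. exact: raddfD. Qed.

Lemma inner0 : inner 0 = 0. Proof. exact: raddf0. Qed.

Lemma innerN w : inner (- w) = - inner w. Proof. exact: raddfN. Qed.

Lemma innerMn w k : inner (w *+ k) = inner w *+ k. Proof. exact: raddfMn. Qed.

Lemma inner_sum J (s : seq J) F :
  inner (\sum_(j <- s) F j) = \sum_(j <- s) inner (F j).
Proof. exact: raddf_sum. Qed.

Lemma inner_digits0 x : digits x = 0 -> x = inner x.2.
Proof. by case: x => v w; rewrite /digits /= => ->. Qed.

Lemma digits_lifted i j : digits (lifted i) j = (j == i)%:R.
Proof. by rewrite ffunE. Qed.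

Lemma lifted3 i : lifted i *+ 3 = inner (r i).
Proof.
rewrite 2!mulrS mulr1n !ext_addE; congr pair; rewrite /= ?addr0.
  by apply/ffunP => j; rewrite !ffunE; case: eqP => _; apply/val_inj.
rewrite !add0r big1 => [|j _]; last by rewrite !ffunE; case: eqP.
rewrite add0r (bigD1 i) //= big1 => [|j /negPf ji]; rewrite !ffunE ?eqxx ?ji //.
exact: addr0.
Qed.

Lemma ext_decomposition (x : E) :
  exists w, x = \sum_i lifted i *+ digits x i + inner w.
Proof.
exists (x - \sum_i lifted i *+ digits x i).2; rewrite -inner_digits0 ?subrKC //.
apply/ffunP => j; rewrite raddfB raddf_sum !ffunE sum_ffunE (bigD1 j) //=.
rewrite big1 => [|i /negPf ij]; rewrite raddfMn ffunMnE digits_lifted.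
  by rewrite eqxx addr0 natr_Zp subrr.
by rewrite eq_sym ij mul0rn.
Qed.

Section Lift.
Variables (A : zmodType) (f : W -> A) (y : I -> A).
Hypothesis fD : {morph f : a b / a + b}.
Hypothesis y3 : forall i, y i *+ 3 = f (r i).
Definition ext_lift (x : E) : A := \sum_i y i *+ digits x i + f x.2.

(** The universal property of the extension: an additive map f on W extends to
    the whole group as soon as f (r i) is divisible by 3, once a third y i of it
    has been chosen for each i. *)
Lemma ext_liftD : {morph ext_lift : a b / a + b}.
Proof.
have f0 : f 0 = 0 by apply: (addrI (f 0)); rewrite -fD !addr0.
have fMn w k : f (w *+ k) = f w *+ k.
  by elim: k => [|k IH]; rewrite ?mulr0n // !mulrS fD IH.
move=> a b; rewrite /ext_lift.
have -> : (a + b).2 = a.2 + b.2 + \sum_i r i *+ carry (a.1 i) (b.1 i).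
  by rewrite ext_addE.
rewrite !fD (big_morph f fD f0) [RHS]addrACA -big_split.
rewrite [LHS]addrCA [RHS]addrC -big_split; congr (_ + _).
apply: eq_bigr => i _ /=; rewrite fMn -y3 -mulrnA raddfD ffunE -!mulrnDr.
by congr (_ *+ _); exact/esym/F3_add_carry.
Qed.

End Lift.

Lemma ext_mulrn3 (x : E) : exists w, x *+ 3 = inner (\sum_i r i *+ digits x i + w *+ 3).
Proof.
have [w {1}->] := ext_decomposition x; exists w.
rewrite mulrnDl -sumrMnl innerD innerMn inner_sum; congr (_ + _).
by apply: eq_bigr => i _; rewrite mulrnAC lifted3 innerMn.
Qed.

End CarryExtension.

Arguments digits {I W r} x : simpl never.
Arguments lifted {I W} r i : simpl never.
Arguments inner {I W} r w : simpl never.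

(** * Groups of class three from alternating double brackets *)

(** A bracket with alternating double brackets, together with a splitting of
    these into the cyclic rotations of a map tri that is alternating in its first
    two arguments only. Both dig and emb record that double brackets depend on the
    arguments modulo the image of the bracket, and take values in a central
    subgroup of exponent 3. *)
Record engel_ring (E : finZmodType) (V : zmodType) (n : nat) := EngelRing {
  br : E -> E -> E;
  dig : {additive E -> V};
  emb : {additive 'rV['F_3]_n -> E};
  tri : V -> V -> V -> 'rV['F_3]_n;
  brDl : forall z, {morph br^~ z : x y / x + y};
  brC : forall x y, br y x = - br x y;
  brxx : forall x, br x x = 0;
  br_emb : forall m x, br (emb m) x = 0;
  dig_br : forall x y, dig (br x y) = 0;
  dig_emb : forall m, dig (emb m) = 0;
  triDl : forall v w, {morph (fun u => tri u v w) : u u' / u + u'};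
  triDr : forall u v, {morph tri u v : w w' / w + w'};
  triC : forall u v w, tri v u w = - tri u v w;
  br_br : forall x y z, br (br x y) z =
    emb (tri (dig x) (dig y) (dig z) + tri (dig y) (dig z) (dig x)
         + tri (dig z) (dig x) (dig y));
  exp27 : forall x : E, x *+ 27 = 0
}.

Section Twist.
Variables (E : finZmodType) (V : zmodType) (n : nat) (L : engel_ring E V n).
Definition twist (_ : engel_ring E V n) : Type := E.
Local Notation G := (twist L).
HB.instance Definition _ := Finite.on G.

Local Notation br := (br L).
Local Notation dig := (dig L).
Local Notation emb := (emb L).
Local Notation tri := (tri L).

Lemma brDr x : {morph br x : y z / y + z}.
Proof. by move=> y z; rewrite !(brC L _ x) brDl opprD. Qed.

Lemma br0 x : br 0 x = 0.
Proof. by apply: (addrI (br 0 x)); rewrite -brDl !addr0. Qed.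

Lemma brN x y : br (- x) y = - br x y.
Proof. by apply/(addrI (br x y)); rewrite -brDl !subrr br0. Qed.

Lemma brMn x y k : br (x *+ k) y = br x y *+ k.
Proof. by elim: k => [|k IH]; rewrite ?br0 // !mulrS brDl IH. Qed.

Lemma brxMn x y k : br x (y *+ k) = br x y *+ k.
Proof. by rewrite brC brMn -mulNrn -brC. Qed.

Lemma br_embr x m : br x (emb m) = 0. Proof. by rewrite brC br_emb oppr0. Qed.

Lemma tri0 v w : tri 0 v w = 0.
Proof. by apply: (addrI (tri 0 v w)); rewrite -triDl !addr0. Qed.

Lemma trix0 u w : tri u 0 w = 0. Proof. by rewrite triC tri0 oppr0. Qed.

Lemma trixx0 u v : tri u v 0 = 0.
Proof. by apply: (addrI (tri u v 0)); rewrite -triDr !addr0. Qed.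

Lemma triN u v w : tri (- u) v w = - tri u v w.
Proof. by apply/(addrI (tri u v w)); rewrite -triDl !subrr tri0. Qed.

Lemma trixxN u v w : tri u v (- w) = - tri u v w.
Proof. by apply/(addrI (tri u v w)); rewrite -triDr !subrr trixx0. Qed.

Lemma triDm u w : {morph (fun v => tri u v w) : v v' / v + v'}.
Proof. by move=> v v'; rewrite !(triC L _ u) triDl opprD. Qed.

Lemma row_mul3 (m : 'rV['F_3]_n) : m *+ 3 = 0.
Proof.
apply/rowP => i; rewrite mulmxnE mxE -mulr_natr [3%:R](_ : _ = 0) ?mulr0 //.
exact/val_inj.
Qed.

Lemma trixx u w : tri u u w = 0.
Proof.
have := triC L u u w; move/eqP; rewrite -addr_eq0 -mulr2n => /eqP t2.
by have := row_mul3 (tri u u w); rewrite mulrS t2 addr0.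
Qed.

(** With the bracket as only correction the product would be associative up to
    twice a double bracket; the last term repairs this. *)
Definition twist_mul (x y : E) : E :=
  x + y + br x y + emb (tri (dig x) (dig y) (dig x - dig y)).
Definition twist_inv (x : E) : E := - x.

Lemma dig_twist_mul x y : dig (twist_mul x y) = dig x + dig y.
Proof. by rewrite !raddfD /= dig_br dig_emb !addr0. Qed.

(** The coboundary of the cochain tri u v (u - v) is the sum of the rotations of
    tri: the two sides differ by three times an element. *)
Lemma tri_cocycle u v w :
  tri u v w + tri v w u + tri w u v + tri (u + v) w (u + v - w) + tri u v (u - v) =
  - (tri v w u + tri w u v + tri u v w) + tri u (v + w) (u - (v + w)) + tri v w (v - w).
Proof.
rewrite !opprD !(triDl, triDm, triDr, trixxN) !addrA.
apply/rowP => i; rewrite !mxE.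
rewrite !(triC L u w) !mxE.
have h3 : forall a : 'F_3, a + a + a = 0.
  by move=> a; rewrite -mulr2n -mulrSr -mulr_natr [3%:R](_ : _ = 0) ?mulr0 //; apply/val_inj.
apply/eqP; rewrite -subr_eq0; set a := tri u v w 0 i; set b := tri v w u 0 i.
apply/eqP; transitivity ((a + a + a) + (b + b + b)); first by ring.
by rewrite !h3 addr0.
Qed.

Lemma br_cocycle (x y z : E) (u := dig x) (v := dig y) (w := dig z) :
  br (br x y) z + emb (tri (u + v) w (u + v - w)) + emb (tri u v (u - v)) =
  br x (br y z) + emb (tri u (v + w) (u - (v + w))) + emb (tri v w (v - w)).
Proof.
by rewrite [br x (br y z)]brC !br_br -[- emb _]raddfN -![emb _ + emb _]raddfD tri_cocycle.
Qed.

Fact twist_mulA : associative twist_mul.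
Proof.
move=> x y z; rewrite [in LHS]/twist_mul [in RHS]/twist_mul !dig_twist_mul.
rewrite !(brDr, brDl) br_embr br_emb !addr0 !addrA.
rewrite [LHS](ACl ((1*2*3*6*7*4)*(8*9*5))) /= -br_cocycle.
by rewrite [RHS](ACl ((1*2*5*3*6*7)*(8*9*4))).
Qed.

Fact twist_mul1 : left_id 0 twist_mul.
Proof. by move=> x; rewrite /twist_mul br0 raddf0 tri0 raddf0 add0r !addr0. Qed.

Fact twist_mulV : left_inverse 0 twist_inv twist_mul.
Proof.
move=> x; rewrite /twist_mul /twist_inv addNr brN brxx oppr0 raddfN triN trixx oppr0.
by rewrite raddf0 !addr0.
Qed.

HB.instance Definition _ := Finite_isGroup.Build G twist_mulA twist_mul1 twist_mulV.

Lemma twist_mulgE (x y : G) : (x * y)%g = twist_mul x y. Proof. by []. Qed.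

Lemma twist_mul_diff x y x' y' : dig x' = dig x -> dig y' = dig y ->
  twist_mul x' y' - twist_mul x y = (x' - x) + (y' - y) + (br x' y' - br x y).
Proof.
move=> xx yy; rewrite /twist_mul xx yy; set e := emb _; rewrite !opprD !addrA.
by rewrite [LHS](ACl (((1*5)*(2*6)*(3*7))*(4*8))) /= subrr addr0 !addrA.
Qed.

Lemma br_engel x y : br (br x y) y = 0.
Proof. by rewrite br_br trixx addr0 (triC L (dig x)) subrr raddf0. Qed.

Lemma br_br4 x y z u : br (br x y) (br z u) = 0.
Proof. by rewrite br_br dig_br trixx0 trix0 tri0 !addr0 raddf0. Qed.

Lemma br_twist_mul x y z : br (twist_mul x y) z = br x z + br y z + br (br x y) z.
Proof. by rewrite !brDl br_emb addr0. Qed.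

Lemma twist_mul_swap (x y : E) : twist_mul x y = twist_mul y x + br x y *+ 2.
Proof.
rewrite /twist_mul (triC L (dig x)) -trixxN opprB (brC L x y) [y + x]addrC.
by rewrite [RHS]addrAC mulr2n addrA subrK.
Qed.

Lemma twist_mul_br x y z : br x (br y z) = 0 -> twist_mul x (br y z *+ 2) = x + br y z *+ 2.
Proof.
by move=> b0; rewrite /twist_mul brxMn b0 raddfMn /= dig_br !mul0rn trix0 raddf0 !addr0.
Qed.

Lemma twist_commg (x y : G) : [~ x, y]%g = br x y *+ 2.
Proof.
have key : twist_mul (twist_mul y x) (br x y *+ 2) = twist_mul x y.
  rewrite twist_mul_br -?twist_mul_swap // br_twist_mul br_br4 addr0 !(brC L (br x y)) br_engel.
  by rewrite [br x y]brC brN br_engel !oppr0 addr0.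
by apply: (mulgI (y * x)%g); rewrite -commgC; exact: (esym key).
Qed.

Lemma twist_expg (x : G) k : (x ^+ k)%g = x *+ k.
Proof.
elim: k => [|k IH]; rewrite ?expg0 // expgS IH twist_mulgE /twist_mul brxMn brxx raddfMn.
rewrite mul0rn mulrS addr0; set v := dig x.
have -> : tri v (v *+ k) (v - v *+ k) = 0; last by rewrite raddf0 addr0.
elim: k {IH} (v - _) => [|k IH] w; first by rewrite trix0.
by rewrite mulrS triDm trixx IH addr0.
Qed.

Lemma dig_mulg (x y : G) : dig (x * y)%g = dig x + dig y.
Proof. exact: (dig_twist_mul x y). Qed.

(** Since x * y and x + y have the same image under dig, a homomorphism to an
    abelian group that is trivial on the kernel of dig cannot tell them apart. *)
Lemma twist_additive (A : zmodType) (h : G -> A) :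
  (forall x y, h (x * y)%g = h x + h y) -> (forall x, dig x = 0 -> h x = 0) ->
  forall x y : E, h (x + y : E) = h x + h y.
Proof.
move=> hM h0 x y; set s : G := (x + y : E).
have: h s = h ((x : G) * (y : G) * (((x : G) * (y : G))^-1 * s))%g.
  by rewrite mulVKg.
set z := (_^-1 * s)%g; rewrite hM hM => ->; rewrite (h0 z) ?addr0 //.
have : dig ((x : G) * (y : G) * z)%g = dig x + dig y by rewrite mulVKg -raddfD.
by rewrite !dig_mulg -[RHS]addr0 => /addrI.
Qed.

Section Endomorphism.
Variable phi : G -> G.
Hypothesis phiM : {morph phi : x y / (x * y)%g}.

Lemma endo_mulrn (x : E) k : phi (x *+ k : E) = phi x *+ k :> E.
Proof.
rewrite -!twist_expg; elim: k => [|k IH]; last by rewrite !expgS phiM IH.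
by apply: (mulgI (phi 1%g)); rewrite expg0 -phiM !mulg1.
Qed.

(** Commutators are doubled brackets, and 14 is an inverse of 2 modulo 27. *)
Lemma endo_br (x y : E) : phi (br x y) = br (phi x) (phi y) :> E.
Proof.
have phiR u w : phi (br u w *+ 2) = br (phi u) (phi w) *+ 2 :> E.
  rewrite -!twist_commg; apply: (mulgI (phi w * phi u)%g).
  by rewrite -commgC -!phiM -commgC.
have half z : z *+ 14 *+ 2 = z :> E.
  by rewrite -mulrnA (_ : 14 * 2 = 27.+1)%N // mulrS (exp27 L) addr0.
rewrite -[br x y]half -[br (phi x) _]half -[br x y *+ 14]brMn phiR.
by rewrite endo_mulrn brMn.
Qed.

End Endomorphism.
End Twist.

(** * Linear algebra over F_3 by computation *)

(** The field F_3 as an enumeration, so that the verifications by computation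
    reduce to pattern matching. *)
Inductive trit := nul | pos | neg.
Definition trit_code a := match a with nul => None | pos => Some true | neg => Some false end.
Definition trit_decode o := match o with None => nul | Some b => if b then pos else neg end.

Lemma trit_codeK : cancel trit_code trit_decode. Proof. by case. Qed.

HB.instance Definition _ := Equality.copy trit (can_type trit_codeK).

Definition trit_add a b :=
  match a, b with
  | nul, _ => b | _, nul => a
  | pos, pos => neg | neg, neg => pos | _, _ => nul
  end.
Definition trit_opp a := match a with nul => nul | pos => neg | neg => pos end.
Definition trit_mul a b :=
  match a with nul => nul | pos => b | neg => trit_opp b end.
Definition trit_val (a : trit) : 'F_3 :=
  match a with nul => 0 | pos => 1 | neg => - 1 end.
Definition is_nul a := match a with nul => true | _ => false end.

Lemma trit_valD a b : trit_val (trit_add a b) = trit_val a + trit_val b.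
Proof. by case: a; case: b; apply/val_inj. Qed.

Lemma trit_valN a : trit_val (trit_opp a) = - trit_val a.
Proof. by case: a; apply/val_inj. Qed.

Lemma trit_valM a b : trit_val (trit_mul a b) = trit_val a * trit_val b.
Proof. by case: a; case: b; apply/val_inj. Qed.

(** Linear forms are sparse, in unknowns indexed by triples of numbers: the
    unknowns of interest are the coordinates j < k of nine bivectors c_i. *)
Definition key := (nat * nat * nat)%type.
Definition form := seq (key * trit).

Definition key_cmp (a b : key) : comparison :=
  match Nat.compare a.1.1 b.1.1 with
  | Eq => match Nat.compare a.1.2 b.1.2 with
          | Eq => Nat.compare a.2 b.2 | c => c end
  | c => c
  end.
Definition key_eq a b := if key_cmp a b is Eq then true else false.

Lemma nat_compare_eq m n : Nat.compare m n = Eq -> m = n.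
Proof. by elim: m n => [|m IH] [|n] //= /IH->. Qed.

Lemma key_cmp_eq a b : key_cmp a b = Eq -> a = b.
Proof.
case: a => [[a1 a2] a3]; case: b => [[b1 b2] b3]; rewrite /key_cmp /=.
case E1: (Nat.compare a1 b1) => //; case E2: (Nat.compare a2 b2) => // E3.
by rewrite (nat_compare_eq E1) (nat_compare_eq E2) (nat_compare_eq E3).
Qed.

Definition form_cons (t : key * trit) (f : form) : form :=
  if is_nul t.2 then f else t :: f.

Fixpoint form_add (f : form) : form -> form :=
  fix add_f (g : form) : form :=
    match f, g with
    | [::], _ => g
    | _, [::] => f
    | s :: f', t :: g' =>
      match key_cmp s.1 t.1 with
      | Lt => s :: form_add f' g
      | Gt => t :: add_f g'
      | Eq => form_cons (s.1, trit_add s.2 t.2) (form_add f' g')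
      end
    end.
Definition form_scale a (f : form) : form :=
  [seq (t.1, trit_mul a t.2) | t <- f].

Fixpoint coef (k : key) (f : form) : trit :=
  if f is t :: f' then if key_eq k t.1 then t.2 else coef k f' else nul.
Definition eliminate (k : key) (a : trit) (r f : form) : form :=
  let c := coef k f in
  if is_nul c then f else form_add f (form_scale (trit_opp (trit_mul c a)) r).

Fixpoint shortest (f : form) (fs : seq form) : form :=
  if fs is g :: fs' then shortest (if (size g < size f)%N then g else f) fs'
  else f.

Definition nonzero (f : form) := ~~ nilp f.

(** Gaussian elimination. While an equation is left, the first unknown of a
    shortest one is eliminated everywhere; choosing short equations keeps the
    system sparse. The number n bounds the number of steps. *)
Fixpoint implied n (rows targets : seq form) : bool :=
  if n is n'.+1 then
    let live := filter nonzero targets in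
    if filter nonzero rows is f :: fs then
      if shortest f fs is ((k, a) :: _) as r then
        implied n' (map (eliminate k a r) (f :: fs)) (map (eliminate k a r) live)
      else false
    else nilp live
  else false.

Definition value (c : key -> 'F_3) (f : form) : 'F_3 :=
  \sum_(t <- f) trit_val t.2 * c t.1.

Section Soundness.
Variable c : key -> 'F_3.

Lemma value_cons t f : value c (t :: f) = trit_val t.2 * c t.1 + value c f.
Proof. by rewrite /value big_cons. Qed.

Lemma value_cat f g : value c (f ++ g) = value c f + value c g.
Proof. by rewrite /value big_cat. Qed.

Lemma value_form_cons t f : value c (form_cons t f) = trit_val t.2 * c t.1 + value c f.
Proof.
by rewrite /form_cons; case: t => k [] /=; rewrite ?value_cons //= mul0r add0r.
Qed.

Lemma value_add f g : value c (form_add f g) = value c f + value c g.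
Proof.
elim: f g => [|s f IHf]; first by case=> [|t g]; rewrite /value big_nil add0r.
elim=> [|t g IHg]; first by rewrite {3}/value big_nil addr0.
rewrite /=; case E: (key_cmp s.1 t.1).
- rewrite value_form_cons IHf !value_cons /= trit_valD (key_cmp_eq E) mulrDl.
  by rewrite addrACA.
- by rewrite value_cons IHf [value c (s :: f)]value_cons addrA.
- by rewrite value_cons IHg [value c (t :: g)]value_cons addrCA.
Qed.

Lemma value_scale a f : value c (form_scale a f) = trit_val a * value c f.
Proof.
rewrite /value big_map mulr_sumr; apply: eq_bigr => t _.
by rewrite trit_valM mulrA.
Qed.

Lemma value_eliminate k a r f : value c r = 0 -> value c (eliminate k a r f) = value c f.
Proof.
by move=> r0; rewrite /eliminate; case: ifP => // _; rewrite value_add value_scale r0 mulr0 addr0.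
Qed.

Lemma shortest_mem f fs : shortest f fs \in f :: fs.
Proof.
elim: fs f => [|g fs IH] f /=; first exact: mem_head.
have := IH (if (size g < size f)%N then g else f).
by rewrite !in_cons; case: ifP => _ /orP[->|->]; rewrite ?orbT.
Qed.

Definition vanish (fs : seq form) := forall f, f \in fs -> value c f = 0.

Lemma vanish_nonzero fs : vanish (filter nonzero fs) -> vanish fs.
Proof.
move=> van f fin; case E: (nilp f); first by rewrite (nilP E) /value big_nil.
by apply: van; rewrite mem_filter /nonzero E.
Qed.

Lemma vanish_eliminate k a r fs : value c r = 0 ->
  vanish (map (eliminate k a r) fs) <-> vanish fs.
Proof.
move=> r0; split=> van f fin.
  by rewrite -(value_eliminate k a f r0); apply/van/map_f.
by have /mapP[g gin ->] := fin; rewrite value_eliminate // van.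
Qed.

Theorem implied_sound n rows targets :
  implied n rows targets -> vanish rows -> vanish targets.
Proof.
elim: n rows targets => //= n IH rows targets imp van; apply: vanish_nonzero.
have {van}: vanish (filter nonzero rows).
  by move=> f; rewrite mem_filter => /andP[_]; apply: van.
case: (filter nonzero rows) imp => [/nilP-> _ g // | f fs].
have := shortest_mem f fs; case: shortest => [//|[k a] r] rin imp van.
have r0 := van _ rin.
apply/(vanish_eliminate k a _ r0); apply: (IH _ _ imp).
exact: (vanish_eliminate k a (f :: fs) r0).2.
Qed.

End Soundness.

Section Tables.
Local Open Scope nat_scope.

(** The map P. Row i lists the two pairs (j, k) such that P(e_i) is the sum of the
    bivectors e_j /\ e_k. The pairs are chosen so that the 45
    relations are independent, cubing is injective, P is rigid, and the linear
    system for c has only the inner solutions. *)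
Definition cube_table : seq ((nat * nat) * (nat * nat)) :=
  [:: ((4, 8), (3, 2)); ((2, 5), (4, 7)); ((1, 7), (8, 3)); ((0, 1), (2, 3));
      ((1, 4), (3, 6)); ((7, 8), (6, 5)); ((0, 4), (3, 5)); ((2, 6), (1, 8));
      ((2, 8), (7, 0))]%N.

(** The coordinates on M: a basis of the alternating trilinear forms f such that
    f(P(x), x) = 0 for all x. An entry (j, k, l, a) stands for a times the minor of
    the coordinates j, k, l. *)
Definition theta : seq (seq (nat * nat * nat * trit)) :=
  [:: [:: (0, 5, 8, pos)];
     [:: (0, 6, 8, pos)];
     [:: (0, 1, 2, pos); (1, 3, 7, pos)];
     [:: (0, 1, 6, pos); (0, 3, 4, pos)];
     [:: (0, 2, 4, pos); (1, 6, 7, neg)];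
     [:: (0, 3, 5, pos); (4, 6, 8, pos)];
     [:: (0, 4, 5, pos); (6, 7, 8, neg)];
     [:: (0, 5, 6, pos); (4, 5, 8, neg)];
     [:: (0, 5, 7, pos); (5, 6, 8, pos)];
     [:: (1, 2, 6, pos); (2, 5, 7, neg)];
     [:: (1, 3, 5, pos); (4, 6, 7, pos)];
     [:: (1, 3, 6, pos); (2, 4, 5, pos)];
     [:: (1, 4, 5, pos); (4, 5, 6, pos)];
     [:: (1, 4, 6, pos); (3, 4, 5, pos)];
     [:: (1, 5, 6, pos); (4, 5, 7, neg)];
     [:: (1, 5, 8, pos); (5, 6, 7, neg)];
     [:: (1, 6, 8, pos); (3, 5, 7, pos)];
     [:: (2, 4, 6, pos); (3, 6, 7, pos)];
     [:: (0, 1, 8, pos); (0, 2, 6, neg); (0, 3, 7, neg)];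
     [:: (0, 2, 5, pos); (1, 2, 3, pos); (3, 4, 7, neg)];
     [:: (0, 2, 8, pos); (1, 2, 7, neg); (2, 3, 8, pos)];
     [:: (0, 3, 6, pos); (1, 3, 4, pos); (2, 3, 4, pos)];
     [:: (0, 6, 7, pos); (1, 5, 7, neg); (3, 5, 8, neg)];
     [:: (0, 1, 4, pos); (1, 3, 4, neg); (2, 3, 4, pos); (4, 6, 7, neg)];
     [:: (0, 1, 5, pos); (0, 4, 6, neg); (3, 5, 6, pos); (4, 5, 6, neg)];
     [:: (0, 2, 6, pos); (1, 3, 8, pos); (2, 3, 7, pos); (2, 4, 7, pos)];
     [:: (0, 2, 7, pos); (1, 7, 8, neg); (2, 6, 7, neg); (4, 5, 7, neg)];
     [:: (0, 3, 8, pos); (1, 6, 7, pos); (2, 4, 8, pos); (3, 6, 8, pos)];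
     [:: (0, 4, 7, pos); (1, 4, 8, neg); (3, 5, 7, neg); (3, 6, 7, neg)];
     [:: (1, 2, 4, pos); (1, 2, 5, pos); (1, 4, 7, neg); (3, 6, 7, pos)];
     [:: (1, 3, 5, pos); (1, 5, 7, pos); (2, 5, 6, neg); (5, 6, 7, pos)];
     [:: (1, 5, 7, pos); (2, 6, 8, neg); (2, 7, 8, neg); (3, 5, 8, neg)];
     [:: (0, 1, 5, pos); (1, 2, 8, neg); (2, 5, 8, pos); (3, 7, 8, neg); (5, 6, 8, neg)];
     [:: (0, 1, 5, pos); (1, 6, 7, neg); (2, 3, 5, neg); (3, 4, 7, neg); (4, 5, 8, pos)];
     [:: (0, 2, 3, pos); (0, 4, 8, pos); (0, 6, 7, neg); (1, 2, 4, neg); (3, 4, 8, neg)];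
     [:: (0, 2, 4, pos); (0, 2, 5, pos); (1, 4, 8, neg); (3, 6, 7, neg); (3, 6, 8, pos)];
     [:: (0, 2, 6, pos); (2, 5, 8, neg); (4, 5, 6, pos); (4, 7, 8, pos); (5, 6, 8, pos)];
     [:: (0, 1, 7, pos); (0, 2, 6, pos); (0, 3, 8, pos); (2, 3, 7, neg);
       (4, 5, 6, neg); (4, 7, 8, neg)];
     [:: (0, 3, 4, pos); (1, 2, 4, pos); (1, 3, 8, neg); (2, 3, 6, pos);
       (2, 4, 7, neg); (4, 6, 8, neg)]].

Definition cube_pairs i := let p := nth ((0,0),(0,0)) cube_table i in [:: p.1; p.2].

(** The linear form w |-> f3(w, e_l) on bivectors, where w is the i-th unknown
    bivector. *)
Definition contraction (f3 : seq (nat * nat * nat * trit)) (i l : nat) : form :=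
  flatten [seq let: (j, k, h, a) := t in
     if l == h then [:: ((i, j, k), a)] else
     if l == j then [:: ((i, k, h), a)] else
     if l == k then [:: ((i, j, h), trit_opp a)] else [::] | t <- f3].
Definition trit_sum (s : seq trit) := foldr trit_add nul s.

(** The value of f3 at (e_u, e_v, e_l). *)
Definition contraction_value f3 u v l : trit := 
   trit_sum [seq let: (_, j, k, a) := t in
       if (j == u) && (k == v) then a
       else if (j == v) && (k == u) then trit_opp a else nul
     | t <- contraction f3 0 l].

(** The value of f3 at (P(e_x), e_l). *)
Definition cube_value f3 x l : trit :=
  trit_sum [seq contraction_value f3 p.1 p.2 l | p <- cube_pairs x].
Definition edge_list := [seq p <- [seq (j, k) | j <- iota 0 9, k <- iota 0 9] | p.1 < p.2].
Definition form_sum (s : seq form) := foldr form_add [::] s.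

(** The coordinate f3 of the equation
    3 c_i = sum of the [c_j, e_k] + [e_j, c_k] over the pairs (j, k) of P(e_i),
    which says that the relation 3 e_i = P(e_i) also holds for the e_i + c_i. *)
Definition cocycle_equation f3 i : form :=
 form_sum ([seq form_cons ((i,p.1,p.2), cube_value f3 p.1 p.2) [::] | p <- edge_list] ++
 flatten [seq [seq [:: t] |
     t <- form_scale neg (contraction f3 p.1 p.2) ++ contraction f3 p.2 p.1] | p <- cube_pairs i]).
Definition cocycle_equations := [seq cocycle_equation f3 i | i <- iota 0 9, f3 <- theta].

(** If c_i = e_i /\ u for all i, then u_k is minus the coordinate (k, 8) of c_8
    for k < 8, and u_8 is the coordinate (0, 8) of c_0. *)
Definition inner_coordinate k : form := if k == 8 then [:: ((0,0,8),pos)] else [:: ((8,k,8),neg)].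
Definition inner_relation i j k : form :=
  form_add [:: ((i,j,k),pos)]
    (if i == j then form_scale neg (inner_coordinate k)
     else if i == k then inner_coordinate j else [::]).
Definition inner_relations := [seq inner_relation i p.1 p.2 | i <- iota 0 9, p <- edge_list].

(** Antisymmetry of P(x) /\ y in M, without which there is no bracket. *)
Definition cube_antisymmetric := all (fun f3 => all (fun i => all (fun j =>
  is_nul (trit_add (cube_value f3 i j) (cube_value f3 j i))) (iota 0 9)) (iota 0 9)) theta.

End Tables.

(** * The ring of order 3^84 *)

Definition edge := {p : 'I_9 * 'I_9 | (p.1 < p.2)%N}.
Notation V9 := {ffun 'I_9 -> 'F_3}.
Notation V36 := {ffun edge -> 'F_3}.
Notation V39 := 'rV['F_3]_39.
Definition theta_nth (m : nat) := nth [::] theta m.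

Definition vcoord (v : V9) (j : nat) : 'F_3 := v (inord j).
Definition ecoord (a : V36) (j k : nat) : 'F_3 :=
  if insub (inord j : 'I_9, inord k : 'I_9) is Some p then a p else 0.

Definition wedge (u v : V9) : V36 :=
  [ffun p : edge => u (val p).1 * v (val p).2 - u (val p).2 * v (val p).1].

(** The part of the minors in which the index taken from w is the largest; the
    rotations of this map add up to the whole of x /\ y /\ z. *)
Definition wedge3 (u v w : V9) : V39 :=
  \row_m \sum_(t <- theta_nth m) let: (j, k, l, c) := t in
     trit_val c * ((vcoord u j * vcoord v k - vcoord u k * vcoord v j) * vcoord w l).
Definition tau (a : V36) (v : V9) : V39 :=
  \row_m \sum_(t <- theta_nth m) let: (j, k, l, c) := t in
     trit_val c * (ecoord a j k * vcoord v l + ecoord a k l * vcoord v j - ecoord a j l * vcoord v k).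

Definition edge_cubes (p : edge) : V39 :=
  \row_m trit_val (cube_value (theta_nth m) (val p).1 (val p).2).
Notation layer2 := (carry_ext edge_cubes).

(** The bivector e_i /\ e_j, for indices in any order. *)
Definition omega (i j : 'I_9) : layer2 :=
  if insub (i, j) is Some p then lifted edge_cubes p
  else if insub (j, i) is Some p then - lifted edge_cubes p else 0.
Definition gen_cubes (i : 'I_9) : layer2 :=
  \sum_(p <- cube_pairs i) omega (inord p.1) (inord p.2).
Notation ring3 := (carry_ext gen_cubes).

Lemma vcoordD u v j : vcoord (u + v) j = vcoord u j + vcoord v j.
Proof. by rewrite /vcoord ffunE. Qed.

Lemma ecoordD a b j k : ecoord (a + b) j k = ecoord a j k + ecoord b j k.
Proof. by rewrite /ecoord; case: insub => [p|]; rewrite ?ffunE ?addr0. Qed.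

Lemma wedgeDl v : {morph wedge^~ v : u u' / u + u'}.
Proof. by move=> u u'; apply/ffunP => p; rewrite !ffunE; ring. Qed.

Lemma wedge0l v : wedge 0 v = 0.
Proof. by apply: (addrI (wedge 0 v)); rewrite -wedgeDl !addr0. Qed.

Lemma wedgeC u v : wedge v u = - wedge u v.
Proof. by apply/ffunP => p; rewrite !ffunE; ring. Qed.

Lemma tauDl v : {morph tau^~ v : a b / a + b}.
Proof.
move=> a b; apply/rowP => m; rewrite !mxE -big_split; apply: eq_bigr.
by move=> [[[j k] l] c] _ /=; rewrite !ecoordD; ring.
Qed.

Lemma tauDr a : {morph tau a : u v / u + v}.
Proof.
move=> u v; apply/rowP => m; rewrite !mxE -big_split; apply: eq_bigr.
by move=> [[[j k] l] c] _ /=; rewrite !vcoordD; ring.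
Qed.

Lemma wedge3Dl v w : {morph (fun u => wedge3 u v w) : u u' / u + u'}.
Proof.
move=> u u'; apply/rowP => m; rewrite !mxE -big_split; apply: eq_bigr.
by move=> [[[j k] l] c] _ /=; rewrite !vcoordD; ring.
Qed.

Lemma wedge3Dr u v : {morph wedge3 u v : w w' / w + w'}.
Proof.
move=> w w'; apply/rowP => m; rewrite !mxE -big_split; apply: eq_bigr.
by move=> [[[j k] l] c] _ /=; rewrite !vcoordD; ring.
Qed.

Lemma wedge3C u v w : wedge3 v u w = - wedge3 u v w.
Proof.
apply/rowP => m; rewrite !mxE -sumrN; apply: eq_bigr.
by move=> [[[j k] l] c] _ /=; ring.
Qed.

Lemma theta_sorted m t : t \in theta_nth m ->
  let: (j, k, l, _) := t in [/\ (j < k)%N, (k < l)%N & (l < 9)%N].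
Proof.
have: all (all (fun t : nat * nat * nat * trit => let: (j, k, l, _) := t in
   [&& j < k, k < l & l < 9])%N) theta by vm_compute.
move/allP => all1; rewrite /theta_nth.
have [mlt|mge] := ltnP m (size theta); last by rewrite nth_default.
move=> tin; have /allP/(_ t tin) := all1 _ (mem_nth [::] mlt).
by case: t {tin} => [[[j k] l] c] /and3P.
Qed.

Lemma ecoordE a j k (jk : (j < k)%N) (k9 : (k < 9)%N) :
  exists p : edge, [/\ ecoord a j k = a p, (val p).1 = inord j & (val p).2 = inord k].
Proof.
have lt : ((inord j : 'I_9, inord k : 'I_9).1 < (inord j : 'I_9, inord k : 'I_9).2)%N.
  by rewrite /= !inordK // (ltn_trans jk).
by exists (Sub (_, _) lt : edge); rewrite /ecoord insubT SubK.
Qed.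

Lemma ecoord_wedge u v j k : (j < k)%N -> (k < 9)%N ->
  ecoord (wedge u v) j k = vcoord u j * vcoord v k - vcoord u k * vcoord v j.
Proof.
move=> jk k9; have [p [-> p1 p2]] := ecoordE (wedge u v) jk k9.
by rewrite ffunE p1 p2.
Qed.

(** Expansion of a minor along its last row, against its expansion by the
    position of the largest index. *)
Lemma tau_wedge u v w :
  tau (wedge u v) w = wedge3 u v w + wedge3 v w u + wedge3 w u v.
Proof.
apply/rowP => m; rewrite !mxE -!big_split; apply: eq_big_seq.
move=> [[[j k] l] c] /theta_sorted[jk kl l9] /=.
have jl := ltn_trans jk kl; have k9 := ltn_trans kl l9.
by rewrite !ecoord_wedge //; ring.
Qed.

Lemma omega_edge (p : edge) : omega (val p).1 (val p).2 = lifted edge_cubes p.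
Proof. by rewrite /omega -surjective_pairing valK. Qed.

Lemma omegaC i j : omega j i = - omega i j.
Proof.
rewrite /omega; case: insubP => [p p1 pE|]; case: insubP => [q q1 qE|] /=.
- by move: p1 q1 => /= /ltnW; rewrite leqNgt => /negP.
- by rewrite ?opprK.
- by [].
by rewrite oppr0.
Qed.

Lemma digits_omega i j :
  digits (omega i j) = wedge (digits (lifted gen_cubes i)) (digits (lifted gen_cubes j)).
Proof.
apply/ffunP => p; rewrite ffunE !digits_lifted -!natrM !mulnb /omega.
have lt0 (q : edge) i' j' : (val q).2 == i' -> (val q).1 == j' -> (i' < j')%N = false.
  by case: q => [[q1 q2] /= q12] /eqP<- /eqP<-; rewrite ltnNge ltnW.
case: insubP => [q q1 qE|ij]; last case: insubP => [q q1 qE|ji] /=.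
- rewrite digits_lifted -val_eqE qE -xpair_eqE -surjective_pairing.
  by case: andP => [[/lt0 H /H]|_]; rewrite ?subr0 // q1.
- rewrite digitsN ffunE digits_lifted -val_eqE qE [(_.2 == i) && _]andbC.
  rewrite -!xpair_eqE -surjective_pairing.
  have /negPf-> : sval p != (i, j) by apply: contraNneq ij => <-; exact: valP p.
  by rewrite sub0r.
have -> : i = j by apply/val_inj/eqP; move: ij ji => /=; lia.
by rewrite digits0 ffunE andbC subrr.
Qed.

(** The bracket takes values in the second layer, and only its part of degree two
    sees the digits with their carries. *)
Definition bracket2 (x y : ring3) : layer2 :=
  \sum_i \sum_j omega i j *+ (digits x i * digits y j)%N
  + inner edge_cubes (tau (digits x.2) (digits y)) - inner edge_cubes (tau (digits y.2) (digits x)).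

Lemma bracket2C x y : bracket2 y x = - bracket2 x y.
Proof.
rewrite /bracket2 opprB opprD addrCA -addrA; congr (_ + _).
rewrite exchange_big -sumrN; apply: eq_bigr => i _; rewrite -sumrN.
by apply: eq_bigr => j _; rewrite omegaC mulNrn mulnC.
Qed.

Notation unit9 i := (digits (lifted gen_cubes i)).

Lemma vcoord_unit9 (l : 'I_9) h : (h < 9)%N -> vcoord (unit9 l) h = (nat_of_ord l == h)%:R.
Proof. by move=> h9; rewrite /vcoord digits_lifted -val_eqE /= inordK // eq_sym. Qed.

Lemma contraction_sorted m i l t : t \in contraction (theta_nth m) i l ->
  [/\ t.1.1.1 = i, (t.1.1.2 < t.1.2)%N & (t.1.2 < 9)%N].
Proof.
case/flattenP=> f /mapP[[[[j k] h] a] /theta_sorted[jk kh h9] ->].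
have [jh k9] := (ltn_trans jk kh, ltn_trans kh h9).
by do 3?case: ifP => _; rewrite ?inE // => /eqP->.
Qed.

Lemma tau_unit9 a (l : 'I_9) m (c : key -> 'F_3) i :
  (forall j k, c (i, j, k) = ecoord a j k) ->
  tau a (unit9 l) 0 m = value c (contraction (theta_nth m) i l).
Proof.
move=> cE; rewrite mxE /value big_flatten big_map; apply: eq_big_seq.
move=> [[[j k] h] b] /theta_sorted[jk kh h9].
have [jh k9] := (ltn_trans jk kh, ltn_trans kh h9); have j9 := ltn_trans jk k9.
rewrite !vcoord_unit9 //; case: ifP => [/eqP lh | _].
  by rewrite big_seq1 cE lh !gtn_eqF //=; ring.
case: ifP => [/eqP lj | _].
  by rewrite big_seq1 cE lj ltn_eqF //= !(mulr0, mulr1, add0r, subr0).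
case: ifP => _; last by rewrite big_nil !(mulr0, add0r, oppr0).
by rewrite big_seq1 cE trit_valN /= !(mulr0, mulr1, add0r) mulrN mulNr.
Qed.

Lemma trit_val_sum s : trit_val (trit_sum s) = \sum_(a <- s) trit_val a.
Proof. by elim: s => [|a s IH] /=; rewrite ?big_nil // big_cons trit_valD IH. Qed.

Lemma contraction_valueE m (u v l : 'I_9) :
  tau (digits (omega u v)) (unit9 l) 0 m = trit_val (contraction_value (theta_nth m) u v l).
Proof.
pose c (k : key) := ecoord (digits (omega u v)) k.1.2 k.2.
rewrite (@tau_unit9 _ l m c 0) // trit_val_sum /value big_map; apply: eq_big_seq.
move=> [[[i j] k] a] /contraction_sorted[_ /= jk k9]; have j9 := ltn_trans jk k9.
rewrite /c digits_omega ecoord_wedge //= !vcoord_unit9 //.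
rewrite ![_ == nat_of_ord _]eq_sym -!natrM !mulnb [(nat_of_ord u == k) && _]andbC.
case: andP => [[/eqP uj /eqP vk]|_].
  by rewrite uj vk gtn_eqF // subr0 mulr1.
by case: andP => _; rewrite ?trit_valN sub0r ?mulrN1 // oppr0 mulr0.
Qed.

Definition cube_pairs_in_range i := let p := cube_pairs i in
  all (fun q : nat * nat => [&& q.1 < 9, q.2 < 9 & q.1 != q.2])%N p.

Lemma cube_pairs_range (i : 'I_9) : cube_pairs_in_range i.
Proof.
have /allP : all cube_pairs_in_range (iota 0 9) by vm_compute.
by apply; rewrite mem_iota ltn_ord.
Qed.

Lemma tau0 v : tau 0 v = 0.
Proof. by apply: (addrI (tau 0 v)); rewrite -tauDl !addr0. Qed.

Lemma taux0 a : tau a 0 = 0.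
Proof. by apply: (addrI (tau a 0)); rewrite -tauDr !addr0. Qed.

Lemma cube_valueE m (i l : 'I_9) :
  tau (digits (gen_cubes i)) (unit9 l) 0 m = trit_val (cube_value (theta_nth m) i l).
Proof.
rewrite /gen_cubes digits_sum (big_morph (tau^~ _) (tauDl _) (tau0 _)) summxE.
rewrite trit_val_sum big_map; apply: eq_big_seq => -[u v] uv.
have /allP/(_ _ uv)/and3P[/= u9 v9 _] := cube_pairs_range i.
by rewrite contraction_valueE !inordK.
Qed.

Lemma edge_cubesE p : edge_cubes p = tau (digits (gen_cubes (val p).1)) (unit9 (val p).2).
Proof. by apply/rowP => m; rewrite [LHS]mxE cube_valueE. Qed.

(** This is where the entries of theta meet those of cube_table. *)
Lemma cube_antisym (i j : 'I_9) :
  tau (digits (gen_cubes i)) (unit9 j) = - tau (digits (gen_cubes j)) (unit9 i).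
Proof.
apply/rowP => m; rewrite [RHS]mxE !cube_valueE; apply/eqP; rewrite -addr_eq0 -trit_valD.
have /allP : cube_antisymmetric by vm_compute.
have mth : theta_nth m \in theta by apply: mem_nth; rewrite ltn_ord.
move=> /(_ _ mth)/allP/(_ i).
rewrite mem_iota ltn_ord => /(_ isT)/allP/(_ j); rewrite mem_iota ltn_ord => /(_ isT).
by case: trit_add.
Qed.

Lemma omega3 i j :
  omega i j *+ 3 = inner edge_cubes (tau (digits (gen_cubes i)) (unit9 j)).
Proof.
rewrite /omega; case: insubP => [p p1 pE|ij]; last case: insubP => [p p1 pE|ji].
- by rewrite lifted3 edge_cubesE pE.
- by rewrite mulNrn lifted3 edge_cubesE pE /= cube_antisym innerN opprK.
have -> : i = j by apply/val_inj/eqP; move: ij ji => /=; lia.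
rewrite mul0rn; symmetry; have := cube_antisym j j; set t := tau _ _ => tN.
have t2 : t + t = 0 by rewrite {2}tN subrr.
have : t *+ 3 = 0 by exact: row_mul3.
by rewrite mulrS mulr2n t2 addr0 => ->; rewrite inner0.
Qed.

Lemma V9_decomposition (v : V9) : v = \sum_i unit9 i *+ v i.
Proof.
apply/ffunP => j; rewrite sum_ffunE (bigD1 j) //= big1 => [|i /negPf ij].
  by rewrite ffunMnE digits_lifted eqxx addr0 natr_Zp.
by rewrite ffunMnE digits_lifted eq_sym ij mul0rn.
Qed.

Lemma tauMnr a v k : tau a (v *+ k) = tau a v *+ k.
Proof. by elim: k => [|k IH]; rewrite ?taux0 // !mulrS tauDr IH. Qed.

Lemma tau_expand a v : tau a v = \sum_i tau a (unit9 i) *+ v i.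
Proof.
rewrite {1}(V9_decomposition v) (big_morph (tau a) (tauDr a) (taux0 a)).
by apply: eq_bigr => i _; rewrite tauMnr.
Qed.

Definition bracket2_gen (y : ring3) (i : 'I_9) : layer2 := \sum_j omega i j *+ digits y j
            - inner edge_cubes (tau (digits y.2) (unit9 i)).

Lemma bracket2_lift x y :
  bracket2 x y =
    ext_lift (fun w => inner edge_cubes (tau (digits w) (digits y))) (bracket2_gen y) x.
Proof.
rewrite /bracket2 /ext_lift addrAC; congr (_ + _); rewrite [tau (digits y.2) _]tau_expand.
rewrite inner_sum -sumrB; apply: eq_bigr => i _.
rewrite /bracket2_gen mulrnBl innerMn -sumrMnl; congr (_ - _).
by apply: eq_bigr => j _; rewrite mulrnA mulrnAC.
Qed.

(** By the universal property of the extension, biadditivity amounts to the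
    compatibility of 3 [e_i, e_j] with [3 e_i, e_j]. *)
Lemma bracket2Dl y : {morph bracket2^~ y : x x' / x + x'}.
Proof.
move=> x x'; rewrite !bracket2_lift ext_liftD // => [w w' | i].
  by rewrite digitsD tauDl innerD.
rewrite /bracket2_gen mulrnBl -innerMn [X in inner _ X]row_mul3 inner0 subr0.
rewrite [tau _ (digits y)]tau_expand inner_sum -sumrMnl.
by apply: eq_bigr => j _; rewrite mulrnAC omega3 innerMn.
Qed.

Lemma ext_exp n (I : finType) (W : finZmodType) (r : I -> W) :
  (forall w : W, w *+ n = 0) -> forall x : carry_ext r, x *+ (3 * n) = 0.
Proof.
move=> Wn x; rewrite mulrnA; have [w ->] := ext_mulrn3 x.
by rewrite -innerMn Wn inner0.
Qed.

Lemma layer2_exp (w : layer2) : w *+ 9 = 0.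
Proof. exact: (ext_exp (n := 3)) (fun m => row_mul3 m) w. Qed.

Lemma ring3_exp (x : ring3) : x *+ 27 = 0.
Proof. exact: (ext_exp (n := 9)) layer2_exp x. Qed.

Lemma digits_inner (I : finType) (W : finZmodType) (r : I -> W) w :
  digits (inner r w) = 0.
Proof. by []. Qed.

Lemma digits_bracket2 x y : digits (bracket2 x y) = wedge (digits x) (digits y).
Proof.
rewrite /bracket2 digitsD digitsN digitsD !digits_inner subr0 addr0 digits_sum.
have wDr v : {morph wedge v : u u' / u + u'}.
  by move=> u u'; rewrite !(wedgeC _ v) wedgeDl opprD.
have w0r v : wedge v 0 = 0 by rewrite wedgeC wedge0l oppr0.
rewrite {2}(V9_decomposition (digits x)) (big_morph (wedge^~ _) (wedgeDl _) (wedge0l _)).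
apply: eq_bigr => i _; rewrite digits_sum.
rewrite {2}(V9_decomposition (digits y)) (big_morph (wedge _) (wDr _) (w0r _)).
apply: eq_bigr => j _; rewrite digitsMn digits_omega.
have wMl u v k : wedge (u *+ k) v = wedge u v *+ k.
  by elim: k => [|k IH]; rewrite ?wedge0l // !mulrS wedgeDl IH.
have wMr u v k : wedge u (v *+ k) = wedge u v *+ k.
  by elim: k => [|k IH]; rewrite ?w0r // !mulrS wDr IH.
by rewrite wMl wMr -mulrnA mulnC.
Qed.

Definition embed : {additive V39 -> ring3} := inner gen_cubes \o inner edge_cubes.
Definition bracket (x y : ring3) : ring3 := inner gen_cubes (bracket2 x y).

Lemma bracket2_inner w y :
  bracket2 (inner gen_cubes w) y = inner edge_cubes (tau (digits w) (digits y)).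
Proof.
rewrite /bracket2 digits_inner taux0 inner0 subr0 big1 ?add0r // => i _.
by rewrite big1 // => j _; rewrite ffunE mul0n.
Qed.

Fact bracketDl y : {morph bracket^~ y : x x' / x + x'}.
Proof. by move=> x x'; rewrite /bracket bracket2Dl innerD. Qed.

Fact bracketC x y : bracket y x = - bracket x y.
Proof. by rewrite /bracket bracket2C innerN. Qed.

Fact bracketxx x : bracket x x = 0.
Proof.
have b2 : bracket x x *+ 2 = 0 by rewrite mulr2n {2}bracketC subrr.
have : bracket x x *+ (1 + 2 * 13) = 0 by exact: ring3_exp.
by rewrite mulrnDr mulrnA b2 mul0rn addr0.
Qed.

Fact bracket_embed m x : bracket (embed m) x = 0.
Proof. by rewrite /bracket bracket2_inner digits_inner tau0 inner0. Qed.

Fact bracket_bracket x y z : bracket (bracket x y) z =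
  embed (wedge3 (digits x) (digits y) (digits z)
    + wedge3 (digits y) (digits z) (digits x) + wedge3 (digits z) (digits x) (digits y)).
Proof. by rewrite {1}/bracket bracket2_inner digits_bracket2 tau_wedge. Qed.

Definition E_ring : engel_ring ring3 V9 39 :=
  EngelRing (dig := @digits _ _ gen_cubes) (emb := embed) bracketDl bracketC bracketxx
   bracket_embed (fun x y => digits_inner _ _) (fun m => digits_inner _ _)
   wedge3Dl wedge3Dr wedge3C bracket_bracket ring3_exp.

(** * Rigidity of the cube map *)

Definition entry (a : seq (seq trit)) i j := nth nul (nth [::] a i) j.
Definition table (f : nat -> nat -> trit) := [seq [seq f i j | j <- iota 0 9] | i <- iota 0 9].
Definition trit_mx (a : seq (seq trit)) : 'M['F_3]_9 := \matrix_(i, j) trit_val (entry a i j).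
Definition trit_sum9 (f : nat -> trit) := trit_sum [seq f j | j <- iota 0 9].

Lemma entry_table f i j : (i < 9)%N -> (j < 9)%N -> entry (table f) i j = f i j.
Proof.
move=> i9 j9; rewrite /entry (nth_map 0%N) ?size_iota // (nth_map 0%N) ?size_iota //.
by rewrite !nth_iota.
Qed.

Lemma trit_val_sum9 f : trit_val (trit_sum9 f) = \sum_(j < 9) trit_val (f j).
Proof.
rewrite /trit_sum9 -(big_mkord xpredT (fun j => trit_val (f j))) /index_iota subn0.
rewrite /trit_sum; elim: (iota 0 9) => [|j s IH] /=; first by rewrite big_nil.
by rewrite trit_valD IH big_cons.
Qed.

Definition table_mul a b :=
  table (fun i k => trit_sum9 (fun j => trit_mul (entry a i j) (entry b j k))).

Lemma trit_mx_mul a b : trit_mx (table_mul a b) = trit_mx a *m trit_mx b.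
Proof.
apply/matrixP => i k; rewrite !mxE entry_table // trit_val_sum9.
by apply: eq_bigr => j _; rewrite !mxE trit_valM.
Qed.

Definition table_trace a := trit_sum9 (fun i => entry a i i).

Lemma trit_mx_trace a : trit_val (table_trace a) = \tr (trit_mx a).
Proof. by rewrite trit_val_sum9; apply: eq_bigr => i _; rewrite mxE. Qed.

(** A row of coefficients as a form in the unknowns (0, 0, j). *)
Definition dense (s : seq trit) : form :=
  foldr (fun j => form_cons ((0, 0, j), nth nul s j)%N) [::] (iota 0 9).
Definition dot (s : seq trit) (z : 'cV['F_3]_9) := \sum_(j < 9) trit_val (nth nul s j) * z j 0.

Lemma value_dense s (z : 'cV['F_3]_9) : value (fun k => z (inord k.2) 0) (dense s) = dot s z.
Proof.
rewrite /dot; under eq_bigr => j _ do rewrite -{2}[j]inord_val.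
rewrite -(big_mkord xpredT (fun j => trit_val (nth nul s j) * z (inord j) 0)).
rewrite /index_iota subn0 /dense; elim: (iota 0 9) => [|j r IH] /=.
  by rewrite /value !big_nil.
by rewrite value_form_cons IH big_cons.
Qed.

Definition injective_forms (fs : seq (seq trit)) :=
  implied 20 [seq dense f | f <- fs] [seq [:: ((0, 0, j), pos)] | j <- iota 0 9]%N.

Lemma injective_formsP fs (z : 'cV['F_3]_9) : injective_forms fs ->
  (forall f, f \in fs -> dot f z = 0) -> z = 0.
Proof.
move=> imp van; apply/colP => j; rewrite mxE.
pose c (k : key) := z (inord k.2) 0.
have /(implied_sound imp) vt : vanish c [seq dense f | f <- fs].
  by move=> _ /mapP[f fin ->]; rewrite value_dense van.
have /vt : [:: ((0, 0, nat_of_ord j), pos)]%N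
    \in [seq [:: ((0, 0, j), pos)] | j <- iota 0 9]%N.
  by apply/mapP; exists (nat_of_ord j); rewrite ?mem_iota ?ltn_ord.
by rewrite /value big_seq1 /c mul1r inord_val.
Qed.

Definition structure_table i := table (fun j k => trit_sum
  [seq if q == (j, k) then pos else if q == (k, j) then neg else nul | q <- cube_pairs i]).

(** The matrix of left multiplication by u for the anticommutative product on
    columns whose i-th coordinate is the bilinear form S_i, where S_i is the
    alternating matrix of P(e_i). *)
Definition left_table (u : seq trit) := table (fun i k =>
  trit_sum9 (fun j => trit_mul (nth nul u j) (entry (structure_table i) j k))).
Definition cube_mx (i : nat) := trit_mx (structure_table i).
Definition left_mul (u : 'cV['F_3]_9) : 'M['F_3]_9 :=
  \matrix_(i, k) \sum_j u j 0 * cube_mx i j k.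
Definition trit_col (u : seq trit) : 'cV['F_3]_9 := \col_j trit_val (nth nul u j).

Lemma left_mul_trit_col u : left_mul (trit_col u) = trit_mx (left_table u).
Proof.
apply/matrixP => i k; rewrite !mxE entry_table // trit_val_sum9.
by apply: eq_bigr => j _; rewrite trit_valM !mxE.
Qed.

Lemma left_mulD : {morph left_mul : u v / u + v}.
Proof.
move=> u v; apply/matrixP => i k; rewrite !mxE -big_split.
by apply: eq_bigr => j _; rewrite mxE mulrDl.
Qed.

(** The vector that represents the linear form tr L_v with respect to the bilinear
    form tr (L_u L_v), where L denotes left multiplication. *)
Definition invariant := [:: nul; pos; neg; pos; nul; nul; neg; pos; neg].

(** A generator of the left kernel of the left multiplication N by the invariant
    vector. *)
Definition left_null := [:: pos; nul; neg; pos; neg; pos; pos; neg; pos].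

(** The coefficients, in increasing degree, of the polynomial q such that t q(t) is
    the characteristic polynomial of N. As 0 is a simple root, q(N) has rank one:
    it maps onto the kernel of N, which the invariant vector spans. *)
Definition annihilator := [:: neg; pos; neg; pos; pos; neg; nul; neg; pos].
Definition unit_trits (a : nat) := [seq if j == a then pos else nul | j <- iota 0 9].
Definition invariant_table := left_table invariant.
Definition row_times r b :=
  [seq trit_sum9 (fun j => trit_mul (nth nul r j) (entry b j k)) | k <- iota 0 9].
Definition trace_forms := let ls := [seq left_table (unit_trits a) | a <- iota 0 9] in
  [seq [seq table_trace (table_mul l l') | l <- ls] | l' <- ls].
Definition trace_form := [seq table_trace (left_table (unit_trits a)) | a <- iota 0 9].
Definition horner_step c x := 
  table (fun i j => trit_add (if i == j then c else nul) (entry (table_mul invariant_table x) i j)).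
Definition null_projection :=
  foldr horner_step (table (fun _ _ => nul)) annihilator ==
  table (fun i j => trit_mul (nth nul invariant i) (nth nul left_null j)).
Definition invariant_is_dual := all (fun a =>
  table_trace (table_mul invariant_table (left_table (unit_trits a))) == nth nul trace_form a)
  (iota 0 9).

Definition trit_row (r : seq trit) : 'rV['F_3]_9 := \row_j trit_val (nth nul r j).

Lemma dotE r z : dot r z = (trit_row r *m z) 0 0.
Proof. by rewrite mxE; apply: eq_bigr => j _; rewrite mxE. Qed.

Lemma nth_map_iota (T : Type) (x : T) f i : (i < 9)%N -> nth x [seq f j | j <- iota 0 9] i = f i.
Proof. by move=> i9; rewrite (nth_map 0%N) ?size_iota // nth_iota. Qed.

Lemma trit_row_times r b : trit_row (row_times r b) = trit_row r *m trit_mx b.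
Proof.
apply/rowP => k; rewrite !mxE nth_map_iota // trit_val_sum9.
by apply: eq_bigr => j _; rewrite !mxE trit_valM.
Qed.

Lemma trit_col_unit (a : 'I_9) : trit_col (unit_trits a) = delta_mx a 0.
Proof.
apply/colP => j; rewrite !mxE nth_map_iota // andbT -val_eqE.
by case: (_ == _).
Qed.

Lemma left_mul_expand v : left_mul v = \sum_(a < 9) v a 0 *: left_mul (trit_col (unit_trits a)).
Proof.
apply/matrixP => i k; rewrite mxE summxE; apply: eq_bigr => a _.
rewrite [RHS]mxE trit_col_unit [X in _ = _ * X]mxE (bigD1 a) //= big1 => [|j /negPf ja].
  by rewrite [delta_mx _ _ _ _]mxE !eqxx mul1r addr0.
by rewrite [delta_mx _ _ _ _]mxE ja mul0r.
Qed.

Lemma left_mulZ k v : left_mul (k *: v) = k *: left_mul v.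
Proof.
apply/matrixP => i j; rewrite !mxE mulr_sumr; apply: eq_bigr => a _.
by rewrite mxE mulrA.
Qed.

Lemma trace_expand z (B : 'M_9) :
  \tr (left_mul z *m B) = \sum_(j < 9) z j 0 * \tr (left_mul (trit_col (unit_trits j)) *m B).
Proof.
rewrite (left_mul_expand z) mulmx_suml raddf_sum; apply: eq_bigr => j _ /=.
by rewrite -scalemxAl mxtraceZ.
Qed.

Lemma row_left_mul i u : row i (left_mul u) = u^T *m cube_mx i.
Proof.
apply/rowP => k; rewrite 2!{1}mxE [RHS]mxE; apply: eq_bigr => j _.
by rewrite [u^T _ _]mxE.
Qed.

Notation inv_col := (trit_col invariant).

Lemma trace_formE v : (trit_row trace_form *m v) 0 0 = \tr (left_mul v).
Proof.
rewrite left_mul_expand raddf_sum mxE; apply: eq_bigr => a _ /=.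
by rewrite mxE nth_map_iota // mxtraceZ left_mul_trit_col trit_mx_trace mulrC.
Qed.

Lemma trace_inv_col v : \tr (left_mul inv_col *m left_mul v) = \tr (left_mul v).
Proof.
rewrite (left_mul_expand v) mulmx_sumr !raddf_sum; apply: eq_bigr => a _ /=.
rewrite -scalemxAr !mxtraceZ !left_mul_trit_col -trit_mx_mul -!trit_mx_trace.
congr (_ * trit_val _).
have /allP/(_ a) : invariant_is_dual by vm_compute.
by rewrite mem_iota ltn_ord => /(_ isT)/eqP->; rewrite nth_map_iota.
Qed.

Fixpoint horner (cs : seq trit) : 'M['F_3]_9 :=
  if cs is c :: cs' then (trit_val c)%:M + left_mul inv_col *m horner cs' else 0.

Lemma trit_mx_table f : trit_mx (table f) = \matrix_(i, j) trit_val (f i j).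
Proof. by apply/matrixP => i j; rewrite !mxE entry_table. Qed.

Lemma hornerE : horner annihilator = inv_col *m trit_row left_null.
Proof.
transitivity (trit_mx (foldr horner_step (table (fun _ _ => nul)) annihilator)).
  elim: annihilator => [|c cs IH] /=.
    by rewrite trit_mx_table; apply/matrixP => i j; rewrite !mxE.
  rewrite IH left_mul_trit_col -trit_mx_mul [in RHS]/horner_step trit_mx_table.
  apply/matrixP => i j; rewrite !mxE trit_valD -val_eqE; congr (_ + _).
  by case: (_ == _).
have /eqP-> : null_projection by vm_compute.
by rewrite trit_mx_table; apply/matrixP => i j; rewrite !mxE big_ord1 !mxE trit_valM.
Qed.

Section Rigidity.
Variable R : 'M['F_3]_9.
Hypothesis RS : forall i : 'I_9, R^T *m cube_mx i *m R = \sum_(l < 9) R i l *: cube_mx l.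

(** The hypothesis on R says that it is an endomorphism of the anticommutative
    product on columns. *)
Lemma left_mul_hom u : left_mul (R *m u) *m R = R *m left_mul u.
Proof.
apply/row_matrixP => i; rewrite !row_mul row_left_mul trmx_mul -!mulmxA.
rewrite [R^T *m _]mulmxA RS mulmx_sumr [RHS]mulmx_sum_row.
by apply: eq_bigr => l _; rewrite -scalemxAr mxE row_left_mul.
Qed.

Lemma left_mul_ker u (g : 'cV_9) : R *m g = 0 -> R *m (left_mul u *m g) = 0.
Proof. by move=> Rg; rewrite mulmxA -left_mul_hom -mulmxA Rg mulmx0. Qed.

Lemma left_mul0 : left_mul 0 = 0.
Proof. by apply: (addrI (left_mul 0)); rewrite -left_mulD !addr0. Qed.

(** The kernel of R is an ideal. If it contains the invariant vector, then it
    contains the image of N, and together these span everything. *)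
Lemma hom_inv_col_0 : R *m inv_col = 0 -> R = 0.
Proof.
move=> R1; have RN : R *m left_mul inv_col = 0 by rewrite -left_mul_hom R1 left_mul0 mul0mx.
apply/row_matrixP => i; rewrite row0; apply: trmx_inj; rewrite trmx0.
have dotc f : dot f (row i R)^T = (R *m trit_col f) i 0.
  by rewrite mxE; apply: eq_bigr => j _; rewrite !mxE mulrC.
apply: (@injective_formsP (invariant ::
    [seq [seq entry invariant_table i k | i <- iota 0 9] | k <- iota 0 9])).
  by vm_compute.
move=> f; rewrite inE dotc => /predU1P[->|/mapP[k]]; first by rewrite R1 mxE.
rewrite mem_iota => k9 ->; rewrite -[RHS](_ : (R *m left_mul inv_col) i (Ordinal k9) = _).
  by rewrite !mxE; apply: eq_bigr => j _; rewrite left_mul_trit_col !mxE nth_map_iota.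
by rewrite RN mxE.
Qed.

(** For h in the kernel of R, the vector q(N) h is a multiple of the invariant
    vector that is killed by R, so that left_null takes the value 0 at h. This
    applies to g and to its multiples L_a g, where these values determine g. *)
Lemma hom_injective (g : 'cV_9) : R *m inv_col != 0 -> R *m g = 0 -> g = 0.
Proof.
move=> R1 Rg.
have kill h : R *m h = 0 -> dot left_null h = 0.
  move=> Rh; have : R *m (horner annihilator *m h) = 0.
    elim: annihilator => [|c cs IH] /=; first by rewrite mul0mx mulmx0.
    rewrite mulmxDl mulmxDr mul_scalar_mx -scalemxAr Rh scaler0 add0r -mulmxA.
    exact: left_mul_ker.
  rewrite hornerE -mulmxA mulmxA dotE; set s := trit_row _ *m h.
  rewrite {1}[s]mx11_scalar mul_mx_scalar => /eqP; rewrite scaler_eq0 (negPf R1) orbF.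
  by move/eqP.
apply: (@injective_formsP (left_null ::
    [seq row_times left_null (left_table (unit_trits a)) | a <- iota 0 9])).
  by vm_compute.
move=> f; rewrite inE => /predU1P[->|/mapP[a _ ->]]; first exact: kill.
by rewrite dotE trit_row_times -mulmxA -dotE -left_mul_trit_col kill // left_mul_ker.
Qed.

(** An automorphism R satisfies L_(R u) = R L_u R^-1, so it preserves traces of
    products of left multiplications. It therefore fixes the invariant vector and
    commutes with N, and it preserves the nine forms v |-> tr L_(N^k v), which are
    linearly independent. *)
Lemma rigidity : R = 0 \/ R = 1%:M.
Proof.
have [/hom_inv_col_0 R0|R1] := eqVneq (R *m inv_col) 0; [by left | right].
have Ru : R \in unitmx.
  rewrite unitmxE unitfE -det_tr; apply/det0P => -[v v0 /(congr1 trmx)].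
  rewrite trmx_mul trmxK trmx0 => /(hom_injective R1) vT.
  by case/eqP: v0; apply: trmx_inj; rewrite vT trmx0.
have conj u : left_mul (R *m u) = R *m left_mul u *m invmx R by rewrite -left_mul_hom mulmxK.
have tr1 u : \tr (left_mul (R *m u)) = \tr (left_mul u).
  by rewrite conj mxtrace_mulC mulmxA mulVmx // mul1mx.
have tr2 u v : \tr (left_mul (R *m u) *m left_mul (R *m v)) = \tr (left_mul u *m left_mul v).
  rewrite !conj -!mulmxA mxtrace_mulC -!mulmxA mulVmx // mulmx1 [invmx R *m _]mulmxA mulVmx //.
  by rewrite mul1mx.
have RF1 : R *m inv_col = inv_col.
  apply/eqP; rewrite -subr_eq0; apply/eqP; set z := _ - _.
  apply: (@injective_formsP trace_forms); first by vm_compute.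
  move=> f /mapP[l' /mapP[a]]; rewrite mem_iota => a9 -> ->.
  transitivity (\tr (left_mul z *m left_mul (trit_col (unit_trits a)))).
    rewrite trace_expand; apply: eq_bigr => j _.
    rewrite (nth_map [::]) ?size_map ?size_iota // nth_map_iota // trit_mx_trace trit_mx_mul.
    by rewrite !left_mul_trit_col mulrC.
  have -> : trit_col (unit_trits a) = R *m (invmx R *m trit_col (unit_trits a)) by rewrite mulKVmx.
  rewrite /z -scaleN1r left_mulD left_mulZ mulmxDl -scalemxAl mxtraceD mxtraceZ.
  rewrite tr2 !trace_inv_col tr1.
  by rewrite mulN1r subrr.
have RN : R *m left_mul inv_col = left_mul inv_col *m R by rewrite -left_mul_hom RF1.
have fixed (v : 'cV_9) : R *m v = v.
  apply/eqP; rewrite -subr_eq0; apply/eqP.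
  apply: (@injective_formsP (traject (row_times^~ invariant_table) trace_form 9)).
    by vm_compute.
  move=> f /trajectP[k _ ->]; rewrite dotE mulmxBr mulmxA.
  suff -> : trit_row (iter k (row_times^~ invariant_table) trace_form) *m R =
            trit_row (iter k (row_times^~ invariant_table) trace_form) by rewrite subrr mxE.
  elim: k => [|k IH] /=.
    apply/rowP => a; have := trace_formE (R *m trit_col (unit_trits a)); rewrite tr1 -trace_formE.
    by rewrite trit_col_unit mulmxA -!colE !mxE.
  by rewrite trit_row_times -left_mul_trit_col -mulmxA -RN mulmxA IH.
apply/matrixP => i j; have /colP/(_ i) := fixed (delta_mx j 0).
by rewrite -colE !mxE andbT.
Qed.

End Rigidity.

(** * Endomorphisms of the group *)

Notation E_mul := (@twist_mul _ _ _ E_ring).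

Lemma digE x : dig E_ring x = digits x. Proof. by []. Qed.

Lemma F3_natmul (a b : 'F_3) : a *+ b = b * a.
Proof. by rewrite -mulr_natl natr_Zp. Qed.

Lemma F3_opp_eq (a : 'F_3) : a = - a -> a = 0.
Proof.
move=> aN; have a2 : a + a = 0 by rewrite {2}aN subrr.
have : a *+ 3 = 0 by rewrite -mulr_natr [3%:R](_ : _ = 0) ?mulr0 //; apply/val_inj.
by rewrite mulrS mulr2n a2 addr0.
Qed.

Lemma ecoord_edge (a : V36) (p : edge) : ecoord a (val p).1 (val p).2 = a p.
Proof. by rewrite /ecoord !inord_val -surjective_pairing valK. Qed.

Lemma edge_sum (F : nat -> nat -> 'F_3) :
  \sum_(p : edge) F (val p).1 (val p).2 = \sum_(q <- edge_list) F q.1 q.2.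
Proof.
transitivity (\sum_(p : 'I_9 * 'I_9 | (p.1 < p.2)%N) F p.1 p.2).
  rewrite (reindex_omap val (insub : _ -> option edge)) /= => [|p p12].
    by apply: eq_bigl => p; rewrite (valP p) valK eqxx.
  by rewrite insubT.
rewrite /edge_list big_filter [RHS]big_mkcond big_allpairs_dep.
have iotaE (H : nat -> 'F_3) : \sum_(j <- iota 0 9) H j = \sum_(j < 9) H j.
  by rewrite -(big_mkord xpredT H).
rewrite iotaE; under [RHS]eq_bigr => j _ do rewrite iotaE.
by rewrite pair_big [LHS]big_mkcond; apply: eq_big => -[j k].
Qed.

Lemma cube_mx_entry (i j k : 'I_9) :
  cube_mx i j k = \sum_(q <- cube_pairs i)
    ((q == (j : nat, k : nat))%:R - (q == (k : nat, j : nat))%:R).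
Proof.
rewrite mxE entry_table // trit_val_sum big_map; apply: eq_big_seq => -[u v] uv.
have /allP/(_ _ uv)/and3P[_ _ /= uv'] := cube_pairs_range i.
case: eqP => [[uj vk]|_]; last by case: eqP => _; rewrite sub0r ?oppr0.
by case: eqP => [[uk _]|_]; rewrite ?subr0 //; rewrite uk vk eqxx in uv'.
Qed.

Lemma cube_mx_skew (i j k : 'I_9) : cube_mx i k j = - cube_mx i j k.
Proof. by rewrite !cube_mx_entry -sumrN; apply: eq_bigr => q _; rewrite opprB. Qed.

Lemma cube_mx_tr (i : 'I_9) : (cube_mx i)^T = - cube_mx i.
Proof. by apply/matrixP => j k; rewrite mxE cube_mx_skew [RHS]mxE. Qed.

Lemma digits_gen_cubes i p : digits (gen_cubes i) p = cube_mx i (val p).1 (val p).2.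
Proof.
rewrite /gen_cubes digits_sum sum_ffunE cube_mx_entry; apply: eq_big_seq => -[u v] uv.
have /allP/(_ _ uv)/and3P[/= u9 v9 _] := cube_pairs_range i.
rewrite digits_omega ffunE !digits_lifted -!natrM !mulnb -!val_eqE /= !inordK //.
by rewrite ![nat_of_ord _ == _]eq_sym.
Qed.

Lemma cube_mx_sandwich (R : 'M['F_3]_9) (i j k : 'I_9) :
  (R^T *m cube_mx i *m R) j k = \sum_(q <- cube_pairs i)
    (R (inord q.1) j * R (inord q.2) k - R (inord q.2) j * R (inord q.1) k).
Proof.
have -> : cube_mx i = \sum_(q <- cube_pairs i)
    (delta_mx (inord q.1) (inord q.2) - delta_mx (inord q.2) (inord q.1)).
  apply/matrixP => a b; rewrite cube_mx_entry summxE; apply: eq_big_seq => -[u v] uv.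
  have /allP/(_ _ uv)/and3P[/= u9 v9 _] := cube_pairs_range i.
  rewrite !mxE -!val_eqE /= !inordK // ![nat_of_ord _ == _]eq_sym.
  by rewrite [(v == nat_of_ord a) && _]andbC.
have sand u v : (R^T *m delta_mx u v *m R) j k = R u j * R v k.
  rewrite -(mul_delta_mx (0 : 'I_1)) mulmxA -mulmxA -rowE -colE mxE big_ord1.
  by rewrite !mxE.
rewrite mulmx_sumr mulmx_suml summxE; apply: eq_bigr => q _.
by rewrite mulmxBr mulmxBl [LHS]mxE sand [X in _ + X]mxE sand.
Qed.

Lemma skew_mx_eq0 (A : 'M['F_3]_9) : A^T = - A ->
  (forall p : edge, A (val p).1 (val p).2 = 0) -> A = 0.
Proof.
move=> AT A0; have AC j k : A k j = - A j k.
  by have /matrixP/(_ j k) := AT; rewrite !mxE.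
have Alt (j k : 'I_9) : (j < k)%N -> A j k = 0.
  by move=> jk; have := A0 (Sub (j, k) jk : edge); rewrite SubK.
apply/matrixP => j k; rewrite mxE; case: (ltngtP j k) => [/Alt //|kj|/val_inj->].
  by rewrite AC Alt ?oppr0.
exact/F3_opp_eq/AC.
Qed.

(** P is injective: the nine bivectors P(e_i) are linearly independent. *)
Lemma gen_cubes_injective (v : V9) :
  (forall p, \sum_i digits (gen_cubes i) p * v i = 0) -> v = 0.
Proof.
move=> v0; pose z : 'cV_9 := \col_i v i.
have: z = 0.
  pose f (q : nat * nat) := [seq entry (structure_table i) q.1 q.2 | i <- iota 0 9].
  apply: (@injective_formsP [seq f q | q <- edge_list]); first by vm_compute.
  move=> g /mapP[[j k]]; rewrite mem_filter => /andP[jk].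
  case/allpairsPdep=> j' [k' []]; rewrite !mem_iota => j9 k9 [? ?] ->; subst j' k'.
  have lt : ((Ordinal j9, Ordinal k9).1 < (Ordinal j9, Ordinal k9).2)%N by [].
  rewrite -[RHS](v0 (Sub (_, _) lt)); apply: eq_bigr => i _.
  by rewrite digits_gen_cubes SubK [z _ _]mxE [in RHS]mxE nth_map_iota.
by move=> z0; apply/ffunP => i; have /colP/(_ i) := z0; rewrite !mxE ffunE.
Qed.

Definition cube_forms : seq form :=
  [seq [seq t <- [seq ((0, q.1, q.2), cube_value theta_nth q.1 q.2)
   | q <- edge_list] | ~~ is_nul t.2] | theta_nth <- theta]%N.
Definition edge_keys : seq form := [seq [:: ((0, q.1, q.2), pos)] | q <- edge_list]%N.

(** Injectivity of cubing from Lambda^2 V to M. *)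
Lemma edge_cubes_injective (a : V36) : \sum_p edge_cubes p *+ a p = 0 -> a = 0.
Proof.
move=> a0; pose c (k : key) := ecoord a k.1.2 k.2.
have vk : vanish c edge_keys.
  apply: (@implied_sound c 40 cube_forms); first by vm_compute.
  move=> g /mapP[s /(nthP [::])[m mlt <-] ->].
  have m39 : (m < 39)%N by [].
  rewrite /value big_filter big_mkcond big_map.
  have /rowP/(_ (Ordinal m39)) := a0; rewrite mxE summxE => am; rewrite -[RHS]am.
  transitivity (\sum_(q <- edge_list)
      trit_val (cube_value (theta_nth m) q.1 q.2) * ecoord a q.1 q.2).
    by apply: eq_bigr => q _ /=; rewrite /theta_nth; case: cube_value => //=; rewrite mul0r.
  rewrite -(edge_sum (fun j k => trit_val (cube_value (theta_nth m) j k) * ecoord a j k)).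
  by apply: eq_bigr => p _; rewrite ecoord_edge mulmxnE mxE F3_natmul mulrC.
apply/ffunP => p; rewrite ffunE -ecoord_edge.
have pin : ((val p).1 : nat, (val p).2 : nat) \in edge_list.
  rewrite mem_filter [X in X && _](valP p) andTb; apply/allpairsPdep.
  by exists (nat_of_ord (val p).1), (nat_of_ord (val p).2); rewrite !mem_iota !ltn_ord.
have /vk := map_f (fun q : nat * nat => [:: ((0, q.1, q.2), pos)]%N) pin.
by rewrite /value big_seq1 mul1r.
Qed.

Lemma inner_inj (I : finType) (W : finZmodType) (r : I -> W) : injective (inner r).
Proof. by move=> w w' /(congr1 snd). Qed.

(** The component in Lambda^2 V. It is additive only when one of the two arguments
    has no component in V, because of the carries. *)
Definition middle (x : ring3) : V36 := digits x.2.

Lemma middle_inner w : middle (inner gen_cubes w) = digits w. Proof. by []. Qed.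

Lemma middleD x y : digits x = 0 -> middle (x + y) = middle x + middle y.
Proof.
move=> x0; rewrite /middle ext_addE /= !digitsD digits_sum big1 ?addr0 // => i _.
have -> : x.1 = 0 by exact: x0.
by rewrite ffunE carryC carry0 digits0.
Qed.

Lemma middleB x y : digits x = 0 -> digits y = 0 -> middle (x - y) = middle x - middle y.
Proof.
move=> x0 y0; rewrite middleD //; congr (_ + _).
by apply/eqP; rewrite -subr_eq0 opprK -middleD ?digitsN ?y0 ?oppr0 // addNr.
Qed.

Lemma middle_bracket x y : middle (bracket x y) = wedge (digits x) (digits y).
Proof. exact: digits_bracket2. Qed.

Lemma middle_mul3 x p : middle (x *+ 3) p = \sum_(i < 9) cube_mx i (val p).1 (val p).2 * digits x i.
Proof.
have [w ->] := ext_mulrn3 x; have [m ->] := ext_mulrn3 w.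
rewrite middle_inner digitsD digits_inner addr0 digits_sum sum_ffunE.
by apply: eq_bigr => i _; rewrite digitsMn ffunMnE digits_gen_cubes F3_natmul mulrC.
Qed.

Lemma mul3_middle0 x : middle (x *+ 3) = 0 -> digits x = 0.
Proof.
move=> m0; apply: gen_cubes_injective => p; rewrite -[RHS](_ : middle (x *+ 3) p = 0).
  by rewrite middle_mul3; apply: eq_bigr => i _; rewrite digits_gen_cubes.
by rewrite m0 ffunE.
Qed.

(** All elements of additive order 3 lie in M, because cubing is injective from V
    to Lambda^2 V and from Lambda^2 V to M. *)
Lemma mul3_eq0 x : x *+ 3 = 0 -> exists m, x = embed m.
Proof.
move=> x3; have x0 : digits x = 0 by apply: mul3_middle0; rewrite x3.
move: x3; rewrite (inner_digits0 x0) -innerMn => /inner_inj.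
have [m ->] := ext_mulrn3 x.2; rewrite -[m *+ 3]/(m *+ 3) row_mul3 addr0 => /inner_inj.
by move=> /edge_cubes_injective/inner_digits0 w0; exists x.2.2; rewrite {1}w0.
Qed.

Lemma digits_bracket x y : digits (bracket x y) = 0. Proof. by []. Qed.

Lemma middle_embed m : middle (embed m) = 0. Proof. by []. Qed.

Lemma bracket_middle0 x y : digits x = 0 -> middle x = 0 -> bracket x y = 0.
Proof.
move=> x0 m0; rewrite (inner_digits0 x0) /bracket bracket2_inner.
by rewrite -[digits _]/(middle x) m0 tau0 inner0.
Qed.

Lemma bracket_digits0 x y : digits x = 0 -> digits y = 0 -> bracket x y = 0.
Proof.
move=> x0 y0; rewrite (inner_digits0 x0) /bracket bracket2_inner y0 taux0.
by rewrite inner0.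
Qed.

Lemma twist_digits0 (x y : ring3) : digits x = 0 -> E_mul x y = x + y + bracket x y.
Proof. by move=> x0; rewrite /twist_mul digE x0 tri0 raddf0 addr0. Qed.

Lemma twistM_digits0 (x y : ring3) : digits x = 0 -> digits y = 0 -> E_mul x y = x + y.
Proof. by move=> x0 y0; rewrite twist_digits0 // bracket_digits0 // addr0. Qed.

Notation unit_elt i := (lifted gen_cubes i).

Lemma bracket_units (i j : 'I_9) :
  bracket (unit_elt i) (unit_elt j) = inner gen_cubes (omega i j).
Proof.
rewrite /bracket /bracket2 digits0 !tau0 inner0 subr0 addr0; congr inner.
rewrite (bigD1 i) //= [X in _ + X]big1 => [|k /negPf ki]; last first.
  by rewrite big1 // => l _; rewrite digits_lifted ki mul0n.
rewrite (bigD1 j) //= big1 => [|k /negPf ki]; last first.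
  by rewrite [unit9 j k]digits_lifted ki muln0.
by rewrite !digits_lifted !eqxx !addr0.
Qed.

Lemma unit_elt3 (i : 'I_9) : unit_elt i *+ 3 =
  \sum_(q <- cube_pairs i) bracket (unit_elt (inord q.1)) (unit_elt (inord q.2)).
Proof.
rewrite lifted3 /gen_cubes inner_sum; apply: eq_bigr => q _.
by rewrite bracket_units.
Qed.

Section Endo.
Variable phi : ring3 -> ring3.
Hypothesis phiM : {morph phi : x y / E_mul x y}.
Let phiMg : {morph (phi : twist E_ring -> twist E_ring) : x y / (x * y)%g} := phiM.

Lemma endo0 : phi 0 = 0.
Proof. by have := endo_mulrn phiMg 0 0; rewrite !mulr0n. Qed.

(** The layers are characterised by the orders of their elements, so every
    endomorphism respects them. *)
Lemma endo_embed m : exists m', phi (embed m) = embed m'.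
Proof.
apply: mul3_eq0; rewrite -(endo_mulrn phiMg) -raddfMn /= row_mul3.
by rewrite raddf0 endo0.
Qed.

Lemma endo_digits0 x : digits x = 0 -> digits (phi x) = 0.
Proof.
move=> x0; have [|m xm] := @mul3_eq0 (phi x *+ 3).
  rewrite -mulrnA -(endo_mulrn phiMg) (inner_digits0 x0) -innerMn layer2_exp.
  by rewrite inner0 endo0.
by apply: mul3_middle0; rewrite xm middle_embed.
Qed.

Lemma endo_digits x : digits (phi x) = \sum_i digits (phi (unit_elt i)) *+ digits x i.
Proof.
have hD : forall x y : ring3, digits (phi (x + y)) = digits (phi x) + digits (phi y).
  apply: (@twist_additive _ _ _ E_ring _ (fun x => digits (phi x : ring3))) => [y z|y].
    by rewrite phiMg -!digE dig_mulg.
  exact: endo_digits0.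
have h0 : digits (phi 0) = 0 by rewrite endo0 digits0.
have [w {1}->] := ext_decomposition x; rewrite hD (endo_digits0 (digits_inner _ w)) addr0.
rewrite (big_morph (fun x => digits (phi x)) hD h0).
by apply: eq_bigr => i _; rewrite (endo_mulrn phiMg) digitsMn.
Qed.

Lemma endo_bracket x y : phi (bracket x y) = bracket (phi x) (phi y).
Proof. exact: (endo_br phiMg). Qed.

Lemma endo_unit3 i : phi (unit_elt i) *+ 3 = \sum_(q <- cube_pairs i)
  bracket (phi (unit_elt (inord q.1))) (phi (unit_elt (inord q.2))).
Proof.
rewrite -(endo_mulrn phiMg) unit_elt3.
elim: (cube_pairs i) => [|q s IH]; first by rewrite !big_nil endo0.
rewrite !big_cons -IH -endo_bracket; set y := \sum_(_ <- s) _.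
have y0 : digits y = 0 by rewrite digits_sum big1.
by rewrite -twistM_digits0 // phiM twistM_digits0 // endo_digits0.
Qed.

Definition endo_mx : 'M['F_3]_9 := \matrix_(i, l) digits (phi (unit_elt i)) l.

(** In the relation 3 e_i = P(e_i), to which phi is applied, the components in
    Lambda^2 V give R^T S_i R = sum_l R_il S_l. *)
Lemma endo_mx_0_or_1 : endo_mx = 0 \/ endo_mx = 1%:M.
Proof.
apply: rigidity => i; apply/eqP; rewrite -subr_eq0; apply/eqP/skew_mx_eq0.
  rewrite raddfB /= !trmx_mul trmxK cube_mx_tr mulNmx mulmxN mulmxA opprB addrC.
  congr (_ - _); rewrite linear_sum -sumrN; apply: eq_bigr => l _ /=.
  by rewrite linearZ /= cube_mx_tr scalerN opprK.
move=> p; rewrite [LHS]mxE cube_mx_sandwich [X in _ + X]mxE summxE.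
have <- : middle (phi (unit_elt i) *+ 3) p =
    \sum_(l < 9) (endo_mx i l *: cube_mx l) (val p).1 (val p).2.
  rewrite middle_mul3; apply: eq_bigr => l _.
  by rewrite [RHS]mxE [endo_mx _ _]mxE mulrC.
apply/eqP; rewrite subr_eq0 endo_unit3; apply/eqP.
elim: (cube_pairs i) => [|q s IH]; first by rewrite !big_nil /middle digits0 ffunE.
rewrite !big_cons middleD // ffunE -IH middle_bracket ffunE !mxE; congr (_ + _).
by congr (_ - _); exact: mulrC.
Qed.

End Endo.

Section EndoPair.
Variables phi iota : ring3 -> ring3.
Hypothesis phiM : {morph phi : x y / E_mul x y}.
Hypothesis iotaM : {morph iota : x y / E_mul x y}.
Hypothesis same_digits : forall x, digits (phi x) = digits (iota x).

Definition endo_sub (x : ring3) : ring3 := phi x - iota x.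
Local Notation D := endo_sub.
Lemma digits_sub x : digits (D x) = 0.
Proof. by rewrite /endo_sub digitsD digitsN same_digits subrr. Qed.

Lemma mul3_diff (x y x' y' : ring3) : digits x' = digits x -> digits y' = digits y ->
  E_mul x' y' - E_mul x y = (x' - x) + (y' - y) + (bracket x' y' - bracket x y).
Proof. exact: (@twist_mul_diff _ _ _ E_ring). Qed.

Lemma middle_diffM (x y : ring3) : middle (D (E_mul x y)) = middle (D x) + middle (D y).
Proof.
have st0 : digits (D x + D y) = 0.
 by rewrite digitsD !digits_sub addr0.
rewrite {1}/endo_sub phiM iotaM mul3_diff // -/(D x) -/(D y).
rewrite (middleD _ st0) (middleD _ (digits_sub x)) middleB // !middle_bracket.
by rewrite !same_digits subrr addr0.
Qed.

(** Two endomorphisms that agree on V differ by a linear map V -> Lambda^2 V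
    modulo M. The difference vanishes on the second layer, which is generated
    modulo M by brackets. It is compared with the trivial endomorphism and with the
    identity. *)
Lemma endo_diff x :
  middle (phi x - iota x) = \sum_i middle (phi (unit_elt i) - iota (unit_elt i)) *+ digits x i.
Proof.
rewrite -!/(D _).
have inner0D w : middle (D (inner gen_cubes w)) = 0.
  have addD u v : middle (D (inner gen_cubes (u + v))) =
      middle (D (inner gen_cubes u)) + middle (D (inner gen_cubes v)).
    by rewrite -middle_diffM twistM_digits0 // innerD.
  have [m ->] := ext_decomposition w.
  rewrite addD [X in _ + X](_ : _ = 0) ?addr0.
    have D00 : middle (D (inner gen_cubes 0)) = 0.
      by apply: (addrI (middle (D (inner gen_cubes 0)))); rewrite -addD !addr0.
    rewrite (big_morph (fun w => middle (D (inner gen_cubes w))) addD D00) big1 // => p _.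
    elim: (nat_of_ord _) => [|k IH]; rewrite ?mulr0n // mulrS addD IH addr0.
    rewrite -omega_edge -bracket_units /endo_sub (endo_bracket phiM) (endo_bracket iotaM).
    rewrite middleB //.
    by rewrite !middle_bracket !same_digits subrr.
  rewrite -[inner gen_cubes _]/(embed m) /endo_sub.
  have [m1 ->] := endo_embed phiM m; have [m2 ->] := endo_embed iotaM m.
  by rewrite middleB // !middle_embed subrr.
have addD : forall u v : ring3, middle (D (u + v)) = middle (D u) + middle (D v).
  apply: (@twist_additive _ _ _ E_ring _ (fun x => middle (D x))) => [u v|u u0].
    exact: middle_diffM.
  by rewrite (inner_digits0 u0) inner0D.
have D0 : middle (D 0) = 0 by have := inner0D 0; rewrite inner0.
have [w {1}->] := ext_decomposition x; rewrite addD inner0D addr0.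
rewrite (big_morph (fun x => middle (D x)) addD D0).
apply: eq_bigr => i _; elim: (nat_of_ord _) => [|k IH]; rewrite ?mulr0n //.
by rewrite !mulrS addD IH.
Qed.

End EndoPair.

Lemma mul3_inner s : digits s = 0 -> s *+ 3 = embed (\sum_p edge_cubes p *+ middle s p).
Proof.
move=> s0; rewrite {1}(inner_digits0 s0) -innerMn.
by have [m ->] := ext_mulrn3 s.2; rewrite row_mul3 addr0.
Qed.

Lemma bracket_inner s y : digits s = 0 -> bracket s y = embed (tau (middle s) (digits y)).
Proof. by move=> s0; rewrite {1}(inner_digits0 s0) /bracket bracket2_inner. Qed.

Lemma embedB m m' : embed (m - m') = embed m - embed m'.
Proof. exact: raddfB. Qed.

Lemma embed_sum J (s : seq J) F :
  embed (\sum_(j <- s) F j) = \sum_(j <- s) embed (F j).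
Proof. exact: raddf_sum. Qed.

Lemma embed_inj : injective embed.
Proof. by move=> m m' /inner_inj/inner_inj. Qed.

Lemma value_sum (c : key -> 'F_3) fs : value c (form_sum fs) = \sum_(f <- fs) value c f.
Proof.
elim: fs => [|f fs IH] /=; first by rewrite /value !big_nil.
by rewrite value_add IH big_cons.
Qed.

Definition unknowns (c : 'I_9 -> V36) (k : key) := ecoord (c (inord k.1.1)) k.1.2 k.2.

Lemma value_contraction c (m : 'I_39) (i l : 'I_9) :
  value (unknowns c) (contraction (theta_nth m) i l) = tau (c i) (unit9 l) 0 m.
Proof. by rewrite (@tau_unit9 (c i) l m (unknowns c) i) // => j k; rewrite /unknowns inord_val. Qed.

Lemma value_cocycle_equation (c : 'I_9 -> V36) (m : 'I_39) (i : 'I_9) :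
  value (unknowns c) (cocycle_equation (theta_nth m) i) =
  (\sum_p edge_cubes p *+ c i p - \sum_(q <- cube_pairs i)
     (tau (c (inord q.1)) (unit9 (inord q.2))
      - tau (c (inord q.2)) (unit9 (inord q.1)))) 0 m.
Proof.
rewrite value_sum big_cat big_map [RHS]mxE; congr (_ + _).
  rewrite summxE -[LHS](edge_sum (fun j k => value (unknowns c)
    (form_cons (nat_of_ord i, j, k, cube_value (theta_nth m) j k) [::]))).
  apply: eq_bigr => p _; rewrite value_form_cons [value _ [::]]big_nil addr0 /unknowns /=.
  by rewrite inord_val ecoord_edge mulmxnE mxE F3_natmul mulrC.
rewrite big_flatten big_map [RHS]mxE summxE -sumrN; apply: eq_big_seq => -[u v] uv.
have /allP/(_ _ uv)/and3P[/= u9 v9 _] := cube_pairs_range i.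
rewrite big_map (eq_bigr (fun t => trit_val t.2 * unknowns c t.1)) => [|t _]; last first.
  exact: big_seq1.
rewrite -/(value _ _) value_cat value_scale [trit_val neg]/(- 1) mulN1r.
have := value_contraction c m (inord u) (inord v).
have := value_contraction c m (inord v) (inord u).
have mxB (A B : V39) : (A - B) 0 m = A 0 m - B 0 m by rewrite !mxE.
by rewrite !inordK // => -> ->; rewrite mxB opprB addrC.
Qed.

(** The linear system for c has no solutions other than those that come from inner
    automorphisms. *)
Lemma inner_solution (c : 'I_9 -> V36) :
  (forall i, \sum_p edge_cubes p *+ c i p = \sum_(q <- cube_pairs i)
     (tau (c (inord q.1)) (unit9 (inord q.2))
      - tau (c (inord q.2)) (unit9 (inord q.1)))) ->
  exists u : V9, forall i, c i = wedge (unit9 i) u.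
Proof.
move=> eqs; have van : vanish (unknowns c) inner_relations.
  apply: (@implied_sound _ 400 cocycle_equations); first by vm_compute.
  move=> f /allpairsPdep[i [t []]]; rewrite mem_iota => i9 /(nthP [::])[m m39 <-] ->.
  have m39' : (m < 39)%N by [].
  rewrite -[nth _ _ _]/(theta_nth (Ordinal m39')) -[i]/(nat_of_ord (Ordinal i9)).
  by rewrite value_cocycle_equation eqs subrr mxE.
exists [ffun k : 'I_9 => value (unknowns c) (inner_coordinate k)] => i; apply/ffunP => p.
have pin : ((val p).1 : nat, (val p).2 : nat) \in edge_list.
  rewrite mem_filter [X in X && _](valP p) andTb; apply/allpairsPdep.
  by exists (nat_of_ord (val p).1), (nat_of_ord (val p).2); rewrite !mem_iota !ltn_ord.
have iin : nat_of_ord i \in iota 0 9 by rewrite mem_iota ltn_ord.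
have /van := allpairs_f (fun i q => inner_relation i q.1 q.2) iin pin.
rewrite /inner_relation value_add /= {1}/value big_seq1 mul1r {1}/unknowns /= inord_val ecoord_edge.
move/eqP; rewrite addr_eq0 => /eqP ->.
rewrite [RHS]ffunE ![unit9 i _]digits_lifted ![[ffun _ => _] _]ffunE.
rewrite -!val_eqE /= ![nat_of_ord _ == i]eq_sym.
case: eqP => [E|_].
  have -> : (nat_of_ord i == (val p).2) = false by rewrite E ltn_eqF // (valP p).
  by rewrite value_scale [trit_val neg]/(- 1) mulN1r opprK mul1r mul0r subr0.
case: eqP => _; rewrite ?mul1r ?mul0r ?sub0r //.
by rewrite [value _ [::]]big_nil oppr0.
Qed.

Section Commutes.
Variable phi : ring3 -> ring3.
Hypothesis phiM : {morph phi : x y / E_mul x y}.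

(** In the form [x, phi(x)] = 0, the E-property. *)
Lemma bracket_endo x : bracket x (phi x) = 0.
Proof.
have digE' i l : digits (phi (unit_elt i)) l = endo_mx phi i l by rewrite mxE.
case: (endo_mx_0_or_1 phiM) => mx.
  have dig0 y : digits (phi y) = digits (0 : ring3).
    rewrite (endo_digits phiM) digits0 big1 // => i _.
    rewrite (_ : digits _ = 0) ?mul0rn //; apply/ffunP => l.
    by rewrite digE' mx mxE ffunE.
  have phi3 i : phi (unit_elt i) *+ 3 = 0.
    rewrite (endo_unit3 phiM) big1 // => q _.
    by apply: bracket_digits0; rewrite dig0 digits0.
  rewrite bracketC bracket_middle0 ?oppr0 ?dig0 ?digits0 //.
  have zeroM : {morph (fun _ => 0) : x y / E_mul x y}.
    by move=> u v; rewrite (twist_mul1 E_ring).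
  rewrite -[phi x]subr0 (endo_diff phiM zeroM dig0) big1 // => i _.
  by have [m ->] := mul3_eq0 (phi3 i); rewrite subr0 middle_embed mul0rn.
have idM : {morph id : x y / E_mul x y} by [].
have dig y : digits (phi y) = digits y.
  rewrite (endo_digits phiM) [RHS]V9_decomposition; apply: eq_bigr => i _.
  by congr (_ *+ _); apply/ffunP => l; rewrite digE' mx mxE digits_lifted eq_sym.
have diff0 y : digits (phi y - y) = 0 by rewrite digitsD digitsN dig subrr.
have [i|u cu] := @inner_solution (fun i => middle (phi (unit_elt i) - unit_elt i)).
  apply: embed_inj; rewrite -mul3_inner // mulrnBl (endo_unit3 phiM) unit_elt3 -sumrB.
  rewrite embed_sum; apply: eq_bigr => q _.
  set a := unit_elt _; set b := unit_elt (inord q.2).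
  rewrite embedB -!bracket_inner //.
  rewrite -{1}[phi a](subrK a) -{1}[phi b](subrK b).
  set s := phi a - a; set t := phi b - b.
  rewrite bracketDl bracketC bracketDl [bracket a (t + b)]bracketC bracketDl.
  rewrite (@bracket_digits0 t s) ?diff0 // add0r -[- bracket b s]bracketC opprD.
  by rewrite [bracket a b]bracketC opprK -addrA subrK.
have mid : middle (phi x - x) = wedge (digits x) u.
  rewrite (endo_diff phiM idM dig) [in RHS](V9_decomposition (digits x)).
  rewrite (big_morph (wedge^~ u) (wedgeDl u) (wedge0l u)); apply: eq_bigr => i _.
  rewrite cu; elim: (nat_of_ord _) => [|k IH]; rewrite ?wedge0l // !mulrS wedgeDl.
  by rewrite -IH.
rewrite -[phi x](subrK x) bracketC bracketDl bracketxx addr0 bracket_inner //.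
rewrite mid tau_wedge (wedge3C (digits x) u) subrr add0r.
have -> : wedge3 (digits x) (digits x) u = 0 by exact: (trixx E_ring).
have -> : embed 0 = 0 by exact: raddf0.
exact: oppr0.
Qed.

End Commutes.

(** * Order, class and the E-property *)

Notation E_group_type := (twist E_ring).
Notation E_set := [set: E_group_type].

Lemma card_edge : #|{: edge}| = 36%N.
Proof.
rewrite card_sub -sum1_card.
transitivity (\sum_(p : 'I_9 * 'I_9 | (p.1 < p.2)%N) 1)%N; first exact: eq_bigl.
rewrite big_mkcond -(pair_big xpredT xpredT (fun i j : 'I_9 => if (i < j)%N then 1 else 0))%N.
by rewrite /= !big_ord_recl !big_ord0.
Qed.

Lemma card_group : #|E_set| = (3 ^ 84)%N.
Proof.
rewrite cardsT [LHS](card_carry_ext gen_cubes) (card_carry_ext edge_cubes) card_edge !card_ord.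
by rewrite card_mx card_ord -!expnD.
Qed.

Lemma E_group_group : E_group E_set.
Proof.
move=> phi _ a _; rewrite twist_commg.
have phiM : {morph (phi : ring3 -> ring3) : x y / E_mul x y}.
  by move=> x y; apply: (morphM phi); rewrite inE.
by rewrite [br _ _ _](bracket_endo phiM) mul0rn.
Qed.

(** The two layers below the top one contain the terms of the lower central
    series. *)
Definition second := [set x : E_group_type | digits (x : ring3) == 0].
Definition third := [set x : E_group_type | (digits (x : ring3) == 0) && (middle x == 0)].

Fact second_group_set : group_set second.
Proof.
apply/group_setP; split=> [|x y]; first by rewrite inE; apply/eqP.
rewrite !inE => /eqP x0 /eqP y0; apply/eqP.
by rewrite -digE dig_mulg !digE x0 y0 addr0.
Qed.

Canonical second_group := Group second_group_set.

Fact third_group_set : group_set third.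
Proof.
apply/group_setP; split=> [|x y]; first by rewrite inE; apply/andP.
rewrite !inE => /andP[/eqP x0 /eqP x1] /andP[/eqP y0 /eqP y1].
rewrite [(x * y)%g](twistM_digits0 x0 y0).
by rewrite digitsD x0 y0 addr0 middleD // x1 y1 addr0 !eqxx.
Qed.

Canonical third_group := Group third_group_set.

Local Close Scope ring_scope.
Local Open Scope group_scope.
Lemma lcn2 : 'L_2(E_set)%g \subset second.
Proof.
rewrite lcnSn gen_subG; apply/subsetP => _ /imset2P[x y _ _ ->].
by rewrite inE twist_commg digitsMn digits_bracket mul0rn.
Qed.

Lemma lcn3 : 'L_3(E_set)%g \subset third.
Proof.
rewrite lcnSn; apply: subset_trans (commSg _ lcn2) _.
rewrite gen_subG; apply/subsetP => _ /imset2P[x y x2 _ ->].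
rewrite inE twist_commg digitsMn digits_bracket mul0rn eqxx mulr2n middleD //.
rewrite middle_bracket; move: x2; rewrite inE => /eqP->.
by rewrite wedge0l addr0 eqxx.
Qed.

Lemma lcn4 : 'L_4(E_set)%g = 1%g.
Proof.
rewrite lcnSn; apply/eqP; rewrite -subG1; apply: subset_trans (commSg _ lcn3) _.
rewrite gen_subG; apply/subsetP => _ /imset2P[x y x2 _ ->].
move: x2; rewrite !inE twist_commg => /andP[/eqP x0 /eqP x1].
by rewrite [br _ _ _](bracket_middle0 _ x0 x1) mul0rn.
Qed.

(** The bracket [[e_0, e_1], e_2] has a nonzero coordinate, because the form of
    index 2 in theta involves the minor (0, 1, 2). *)
Lemma lcn3_neq1 : 'L_3(E_set)%g != 1%g.
Proof.
pose e (i : nat) : E_group_type := unit_elt (inord i).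
have : [~ [~ e 0%N, e 1%N], e 2%N] \in 'L_3(E_set)%g.
  by rewrite !lcnSn lcn1; do 2?apply: mem_commg; rewrite inE.
apply: contraTneq => ->; rewrite inE !twist_commg.
rewrite [br _ _ _](_ : _ =
    embed (tau (digits (omega (inord 0%N) (inord 1%N))) (unit9 (inord 2%N)) *+ 2)%R).
  rewrite -[(_ *+ 2)%R]raddfMn -mulrnA /=; apply/negP => /eqP/(embed_inj (x2 := 0%R)).
  move/rowP/(_ (inord 2%N)); rewrite mulmxnE contraction_valueE mxE !inordK //.
rewrite brMn [RHS]raddfMn; congr (_ *+ _)%R.
rewrite -[br _ (e 0%N) _]/(bracket (unit_elt (inord 0%N)) (unit_elt (inord 1%N))).
by rewrite bracket_units; exact: (@bracket_inner (inner gen_cubes _)).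
Qed.

Local Close Scope group_scope.

Theorem theorem1p1 :
  exists (gT : finGroupType) (G : {group gT}),
    [/\ #|G| = (3 ^ 84)%N, nilpotent G, nil_class G = 3 & E_group G].
Proof.
have nilG : nilpotent E_set by apply/lcnP; exists 3; exact: lcn4.
exists E_group_type, [set: E_group_type]%G; split=> //.
- exact: card_group.
- apply/eqP; rewrite eqn_leq; apply/andP; split.
    by apply/(lcn_nil_classP _ nilG); exact: lcn4.
  by rewrite ltnNge; apply/(lcn_nil_classP _ nilG)/eqP/lcn3_neq1.
- exact: E_group_group.
Qed.
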